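(* Let $n\ge1$, let $\lambda$ be a partition of $n$, and let $\Phi_n=\sum_{m=0}^{\lfloor(n-1)/2\rfloor}[n-2m,1^{2m}]$. If $n$ is odd, then $$\langle S^2([\lambda])-A^2([\lambda]),\Phi_n\rangle=\begin{cases}\frac12(1+(-1)^k)&\text{if }\lambda=(n-k,1^k),\\0&\text{otherwise.}\end{cases}$$ If $n$ is even, then $$\langle S^2([\lambda])-A^2([\lambda]),\Phi_n\rangle=\begin{cases}\frac12(1+(-1)^k)&\text{if }\lambda=(n-k,1^k)\text{ and }n-k>k,\\\frac12(1+(-1)^{k-1})&\text{if }\lambda=(n-k,1^k)\text{ and }n-k\le k,\\\frac12[\lambda]\bigl((\tfrac n2,\tfrac n2)\bigr)&\text{otherwise.}\end{cases}$$ In any case, $\langle S^2([\lambda])-A^2([\lambda]),\Phi_n\rangle\in\{-1,0,1\}$; i.e., the numbers of constituents (counted with multiplicity) in $S^2([\lambda])$ and $A^2([\lambda])$ labelled by hooks of even leg length differ by at most one.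
   Context: For a partition $\lambda$ of $n$, $[\lambda]$ denotes the irreducible complex character of the symmetric group $S_n$ labelled by $\lambda$; $[\lambda](\mu)$ denotes its value on elements of cycle type $\mu$; $\langle\cdot,\cdot\rangle$ is the usual scalar product of class functions. For a character $\chi$ of a finite group, $S^2(\chi)(g)=\tfrac12(\chi(g)^2+\chi(g^2))$ and $A^2(\chi)(g)=\tfrac12(\chi(g)^2-\chi(g^2))$. A hook is a partition $(n-k,1^k)$ with $0\le k\le n-1$; its leg length is $k$. *)

(* Defs.v *)
From HB Require Import structures.
From mathcomp Require Import all_boot all_order all_algebra.
From mathcomp Require Import all_fingroup all_solvable all_field all_character.

Set Implicit Arguments.
Unset Strict Implicit.
Unset Printing Implicit Defensive.

Import Order.TTheory GRing.Theory Num.Theory.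
Local Open Scope ring_scope.

Definition is_partition (n : nat) (la : seq nat) : bool :=
  [&& sorted geq la, 0%N \notin la & sumn la == n].

Definition hook (n k : nat) : seq nat := (n - k)%N :: nseq k 1%N.

Definition is_hook (n : nat) (la : seq nat) : Prop :=
  exists2 k, (k < n)%N & la = hook n k.

Definition cycle_type (n : nat) (s : 'S_n) : seq nat :=
  sort geq [seq #|X| | X : {set 'I_n} <- enum (porbits s)].

Section Specht.

Variables (n : nat) (la : seq nat).

(* Row and column stabilisers of the row-reading tableau of shape la: the
   first row is filled with 0, 1, .., la_0 - 1, the second one with the next
   la_1 numbers, and so on; i lies in row reshape_index la i and column
   reshape_offset la i. *)
Definition row_stab : {set 'S_n} :=
  [set s : 'S_n | [forall i, reshape_index la (s i) == reshape_index la i]].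

Definition col_stab : {set 'S_n} :=
  [set s : 'S_n | [forall i, reshape_offset la (s i) == reshape_offset la i]].

(* The Young symmetrizer \sum_(r, c) sgn(c) r c, as a vector of the regular
   module algC['S_n]. *)
Definition young_symmetrizer : 'rV[algC]_#|[set: 'S_n]| :=
  \sum_(r in row_stab) \sum_(c in col_stab)
     (-1) ^+ odd_perm c *:
       gring_row (regular_repr algC [set: 'S_n]%G (r * c)%g).

(* The character of the Specht module, i.e. of the right ideal of algC['S_n]
   generated by the Young symmetrizer; (n) labels the trivial character and
   (1^n) the sign character. *)
Definition specht_char : 'CF([set: 'S_n]) :=
  cfRepr (submod_repr (cyclic_mx_module (regular_repr algC [set: 'S_n]%G)
                                        young_symmetrizer)).

End Specht.

Section Squares.

Variables (gT : finGroupType) (G : {group gT}) (chi : 'CF(G)).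

Fact sym_sq_subproof : is_class_fun <<G>>%g
  [ffun g => (chi g ^+ 2 + chi (g ^+ 2)%g) / 2 *+ (g \in G)].
Proof.
rewrite genGid; apply: intro_class_fun => [x y Gx Gy | x /negbTE-> //].
by rewrite -conjXg !cfunJ // groupJr.
Qed.
Definition sym_sq : 'CF(G) := Cfun 0 sym_sq_subproof.

Fact alt_sq_subproof : is_class_fun <<G>>%g
  [ffun g => (chi g ^+ 2 - chi (g ^+ 2)%g) / 2 *+ (g \in G)].
Proof.
rewrite genGid; apply: intro_class_fun => [x y Gx Gy | x /negbTE-> //].
by rewrite -conjXg !cfunJ // groupJr.
Qed.
Definition alt_sq : 'CF(G) := Cfun 0 alt_sq_subproof.

End Squares.

Definition even_hook_char (n : nat) : 'CF([set: 'S_n]) :=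
  \sum_(m < (n.-1)./2.+1) specht_char n (hook n m.*2).

Definition even_hook_constituents (n : nat) (chi : 'CF([set: 'S_n])) : algC :=
  \sum_(i : Iirr [set: 'S_n]
         | [exists k : 'I_n, ~~ odd k && ('chi_i == specht_char n (hook n k))])
     '[chi, 'chi_i].

(* Main.v *)
Require Import Defs.
From mathcomp Require Import all_boot all_order all_algebra.
From mathcomp Require Import all_fingroup all_solvable all_field all_character.
From mathcomp Require Import zify ring.

Set Implicit Arguments.
Unset Strict Implicit.
Unset Printing Implicit Defensive.

Import Order.TTheory GRing.Theory Num.Theory.
Local Open Scope ring_scope.

(** Let chi be the character labelled by lambda. As S^2(chi) - A^2(chi) takes
    the value chi(g^2) at g, the scalar product is the mean over g of chi(g^2)
    Phi(g). The values of the hook characters have a generating function: (1 +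
    q) times the sum over k of q^k [n-k,1^k](g) is the product, over the
    cycles O of g, of 1 - (-q)^|O| [hook_gen]. So 2 Phi = T + N, where T, the
    value at q = 1, vanishes unless all cycles of g are odd [hook_sum_even],
    and N, the value at q = -1, vanishes unless g is an n-cycle
    [hook_altsum_orbits]; moreover N has mean 1 [hook_altsum_total].

    By the Jacobi-Trudi formula [specht_jacobi_trudi], chi is an integral
    combination of permutation characters on words, so chi(g) depends only on
    the set of words that g fixes. If all cycles of g are odd, g and g^2 fix
    the same words and chi(g^2) = chi(g). Therefore T contributes the scalar
    product of chi with the sum of all hooks, which is 1 or 0, and for n odd N
    contributes that with their alternating sum. For n even, the square of an
    n-cycle has two cycles of length n/2, where chi takes a constant value V
    [specht_two_orbits], and N contributes V. For a hook, V is read off the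
    generating function; otherwise at most two terms of the determinant
    survive, they are equal and of absolute value 1, so that V is -2, 0 or 2
    [two_orbit_value_bound].

    The Specht module is the right ideal of a b, where a sums the row
    stabiliser and b is the signed sum over the column stabiliser. It is
    contained in the ideal of a, which affords the character induced from the
    trivial one of the row stabiliser, and it is a quotient of the ideal of b,
    which affords the one induced from the sign of the column stabiliser. By
    Mackey's formula [word_char_cfdot] the scalar product of the two induced
    characters counts 0-1 matrices with the row and column sums of the diagram
    of lambda, and there is just one [row_col_cfdot]. Hence the Specht
    character is irreducible and is the only common constituent of the two
    [specht_char_spec]. All identifications rest on this: the Jacobi-Trudi
    determinant has norm 1 by a sign-reversing involution on integer matrices
    [jacobi_trudi_count] and has scalar product 1 with both induced
    characters; and the character induced from the trivial character times the
    sign of S_(n-j) x S_j shares [n-j,1^j] with the next one in j and has norm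
    at most 2, so it is a sum of two consecutive hooks [mixed_hook_pieri],
    which yields the generating function. *)

(** * Idempotents commuting with a representation *)

Section Idempotents.

Variables (gT : finGroupType) (G : {group gT}) (n : nat).
Variable rG : mx_representation algC G n.

Lemma centgmx_module (P : 'M_n) : centgmx rG P -> mxmodule rG P.
Proof.
move/centgmxP=> cP; apply/mxmoduleP=> x Gx.
by rewrite cP // submxMl.
Qed.

(** Any two projectors P and Q onto the same submodule satisfy P Q = P and Q P
    = Q, so traces against them agree; the representation on a submodule is
    the trace against the projector Q built from its coordinates. *)
Lemma mxtrace_submod_idem (U P : 'M_n) (modU : mxmodule rG U) x :
  x \in G -> (P :=: U)%MS -> P *m P = P ->
  \tr (submod_repr modU x) = \tr (P *m rG x).
Proof.
move=> Gx eqPU idP; pose Q := val_submod (in_submod U 1%:M).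
have QE m (W : 'M_(m, n)) : W *m Q = val_submod (in_submod U W).
  by rewrite /Q [in LHS]val_submodE mulmxA -in_submodE -val_submodE.
have mulQ m (W : 'M_(m, n)) : (W <= U)%MS -> W *m Q = W.
  by move=> sWU; rewrite QE in_submodK.
have mulP m (W : 'M_(m, n)) : (W <= U)%MS -> W *m P = W.
  move=> sWU; have /submxP[D ->] : (W <= P)%MS by rewrite eqPU.
  by rewrite -mulmxA idP.
transitivity (\tr (rG x *m Q)).
  by rewrite -[submod_repr modU x]mulmxA mxtrace_mulC -val_submodE QE.
rewrite -{1}(mulP _ Q (val_submodP _)) mulmxA mxtrace_mulC mulmxA.
by rewrite mulQ // mxmodule_trans ?eqPU.
Qed.

Lemma idem_char (P : 'M_n) : centgmx rG P -> P *m P = P ->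
  exists2 phi : 'CF(G), phi \is a character
    & {in G, forall x, phi x = \tr (P *m rG x)}.
Proof.
move=> cP idP; exists (cfRepr (submod_repr (centgmx_module cP))).
  exact: cfRepr_char.
by move=> x Gx; rewrite cfunE Gx mulr1n (mxtrace_submod_idem _ Gx _ idP).
Qed.

(** P - Q is an idempotent as well: it cuts out a complement of the image of Q
    in that of P. *)
Lemma idem_sub_char (P Q : 'M_n) (phi psi : 'CF(G)) :
    centgmx rG P -> centgmx rG Q -> P *m P = P -> Q *m Q = Q ->
    P *m Q = Q -> Q *m P = Q ->
    {in G, forall x, phi x = \tr (P *m rG x)} ->
    {in G, forall x, psi x = \tr (Q *m rG x)} ->
  phi - psi \is a character.
Proof.
move=> cP cQ idP idQ PQ QP phiE psiE.
have cPQ : centgmx rG (P - Q).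
  apply/centgmxP=> x Gx.
  by rewrite mulmxBl mulmxBr (centgmxP cP) // (centgmxP cQ).
have idPQ : (P - Q) *m (P - Q) = P - Q.
  by rewrite mulmxBl !mulmxBr idP idQ PQ QP subrr subr0.
have [eta Ceta etaE] := idem_char cPQ idPQ.
suff -> : phi - psi = eta by [].
apply/cfun_inP=> x Gx.
by rewrite !cfunE phiE // psiE // etaE // mulmxBl linearB.
Qed.

Lemma centgmxM (P Q : 'M_n) :
  centgmx rG P -> centgmx rG Q -> centgmx rG (P *m Q).
Proof.
move=> /centgmxP cP /centgmxP cQ; apply/centgmxP=> x Gx.
by rewrite -mulmxA cQ // !mulmxA cP.
Qed.

(** Maschke's averaging argument, applied to a generalized inverse. *)
Lemma centgmx_pinv (Z : 'M_n) : centgmx rG Z ->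
  exists2 Y : 'M_n, centgmx rG Y & Z *m Y *m Z = Z.
Proof.
move=> /centgmxP cZ.
(* An arbitrary generalized inverse, to be averaged over the group. *)
have [Zi ZiK] : exists Zi, Z *m Zi *m Z = Z
  by exists (pinvmx Z); rewrite mulmxKpV.
pose Y := #|G|%:R^-1 *: \sum_(x in G) (rG x^-1%g *m Zi *m rG x).
exists Y.
  apply/centgmxP=> y Gy; rewrite /Y -scalemxAl -scalemxAr; congr (_ *: _).
  rewrite mulmx_suml mulmx_sumr (reindex_inj (mulIg y^-1%g)) /=.
  apply: eq_big => [x | x Gxy]; first by rewrite groupMr ?groupV.
  have Gx : x \in G by rewrite -(groupMr x (groupVr Gy)).
  rewrite invMg invgK -!mulmxA -repr_mxM ?groupM ?groupV // mulgKV.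
  by rewrite !mulmxA -repr_mxM ?groupV.
rewrite /Y -scalemxAr -scalemxAl mulmx_sumr mulmx_suml.
rewrite (eq_bigr (fun _ => Z)) => [|x Gx]; last first.
  rewrite -!mulmxA -cZ // !mulmxA cZ ?groupV // -!(mulmxA (rG x^-1%g)).
  by rewrite ZiK mulmxA -cZ ?groupV // -mulmxA -repr_mxM ?groupV // mulVg
    repr_mx1 mulmx1.
rewrite sumr_const -scaler_nat scalerA mulVf ?scale1r //.
by rewrite pnatr_eq0 -lt0n cardG_gt0.
Qed.

(** The image U of Q P lies in that of P and is a quotient of that of Q. If Y
    is an equivariant generalized inverse of Z = Q P, then Y Z projects onto
    U, and P Y Z and Z Y Q are idempotents below P and Q with the same traces
    as Y Z. *)
Lemma idem_mul_char (P Q U : 'M_n) (phi psi : 'CF(G)) (modU : mxmodule rG U) :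
    centgmx rG P -> centgmx rG Q -> P *m P = P -> Q *m Q = Q ->
    (U :=: Q *m P)%MS ->
    {in G, forall x, phi x = \tr (P *m rG x)} ->
    {in G, forall x, psi x = \tr (Q *m rG x)} ->
  phi - cfRepr (submod_repr modU) \is a character /\
  psi - cfRepr (submod_repr modU) \is a character.
Proof.
move=> cP cQ idP idQ eqU phiE psiE; set Z := Q *m P in eqU.
have cZ : centgmx rG Z by apply: centgmxM.
have [Y cY ZYZ] := centgmx_pinv cZ.
have ZP : Z *m P = Z by rewrite /Z -mulmxA idP.
have QZ : Q *m Z = Z by rewrite /Z mulmxA idQ.
clearbody Z; have [E defE] : exists E, E = Y *m Z by eexists.
have idE : E *m E = E by rewrite defE -mulmxA (mulmxA Z) ZYZ.
have eqE : (E :=: U)%MS.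
  apply/eqmxP; rewrite !eqU defE submxMl /=.
  by rewrite -{1}ZYZ -mulmxA submxMl.
have UE x : x \in G -> cfRepr (submod_repr modU) x = \tr (E *m rG x).
  by move=> Gx; rewrite cfunE Gx mulr1n (mxtrace_submod_idem _ Gx eqE idE).
have cE : centgmx rG E by rewrite defE; apply: centgmxM.
have EP : E *m P = E by rewrite defE -mulmxA ZP.
split.
  have idPE : P *m E *m (P *m E) = P *m E.
    by rewrite -!mulmxA (mulmxA E P) EP idE.
  apply: (@idem_sub_char P (P *m E)) => //; first exact: centgmxM.
  - by rewrite mulmxA idP.
  - by rewrite -mulmxA EP.
  move=> x Gx; rewrite UE // -(mulmxA P) [RHS]mxtrace_mulC -mulmxA.
  by rewrite -(centgmxP cP) // mulmxA EP.
apply: (@idem_sub_char Q (Z *m Y *m Q)) => //.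
- by apply: centgmxM => //; apply: centgmxM.
- by rewrite -!mulmxA (mulmxA Q Z) QZ (mulmxA Y) (mulmxA Z) (mulmxA Z) ZYZ.
- by rewrite !mulmxA QZ.
- by rewrite -mulmxA idQ.
move=> x Gx; rewrite UE // -!mulmxA [RHS]mxtrace_mulC defE.
by rewrite -!mulmxA -(centgmxP cZ) // (mulmxA Q) QZ.
Qed.

End Idempotents.

Section CommonConstituent.

Variables (gT : finGroupType) (G : {group gT}).

Lemma cfdot_char_le (phi psi alpha beta : 'CF(G)) :
    phi \is a character -> psi \is a character ->
    alpha \is a character -> beta \is a character ->
    phi - alpha \is a character -> psi - beta \is a character ->
  '[alpha, beta] <= '[phi, psi].
Proof.
move=> Cphi Cpsi Ca Cb Cpa Cpb.
have -> : '[phi, psi] = '[phi - alpha, psi] + '[alpha, psi - beta] + '[alpha,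
  beta].
  by rewrite -addrA -cfdotDr subrK -cfdotDl subrK.
by rewrite lerDr natr_ge0 ?rpredD ?Cnat_cfdot_char.
Qed.

(** A scalar product 1 leaves room for a single common constituent, of
    multiplicity one on both sides. *)
Lemma irr_of_cfdot1 (phi psi chi : 'CF(G)) :
    phi \is a character -> psi \is a character -> chi \is a character ->
    chi != 0 -> phi - chi \is a character -> psi - chi \is a character ->
    '[phi, psi] = 1 ->
  chi \in irr G /\
  (forall i, '[phi, 'chi_i] != 0 -> '[psi, 'chi_i] != 0 -> 'chi_i = chi).
Proof.
move=> Cphi Cpsi Cchi nz_chi Cphi' Cpsi' dot1.
have chi1 : '[chi] = 1.
  apply/le_anti; rewrite -{1}dot1 cfdot_char_le //=.
  have /natrP[m Dm] := Cnat_cfdot_char Cchi Cchi.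
  have : '[chi] != 0 by rewrite cfnorm_eq0.
  by rewrite Dm pnatr_eq0 (ler_nat _ 1) lt0n.
have irr_chi : chi \in irr G by rewrite irrEchar Cchi chi1 eqxx.
split=> // i nz_phi nz_psi; have /irrP[j Dj] := irr_chi.
rewrite Dj; apply: contraTeq isT => /= neq_ij.
have{neq_ij} dij : '['chi_j, 'chi_i] = 0.
  by rewrite cfdot_irr; case: (eqVneq j i) neq_ij => // ->; rewrite eqxx.
have sub1 (xi : 'CF(G)) : xi \is a character -> '[xi, 'chi_i] != 0 ->
    xi - chi \is a character -> xi - chi - 'chi_i \is a character.
  move=> Cxi nz Cxi'; have Ci : i \in irr_constt (xi - chi).
    by rewrite irr_consttE cfdotBl Dj dij subr0.
  have [eta Ceta ->] := constt_charP i Cxi' Ci.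
  by rewrite addrC addKr.
have := cfdot_char_le Cphi Cpsi (rpredD Cchi (irr_char i))
  (rpredD Cchi (irr_char i)).
rewrite !opprD !addrA dot1 => /(_ (sub1 _ Cphi nz_phi Cphi')
  (sub1 _ Cpsi nz_psi Cpsi')).
rewrite cfdotDl !cfdotDr chi1 Dj dij [X in _ + X](_ : _ = 1); last first.
  by rewrite cfdotC dij conjC0 add0r cfdot_irr eqxx.
by rewrite addr0 -{3}[1]add0r lerD2r ler10.
Qed.

End CommonConstituent.

(** * Induced linear characters and Young symmetrizers in the group algebra *)

Section InducedLinear.

Variable gT : finGroupType.
Implicit Types (H K R C : {group gT}) (b : gT -> bool).

Local Notation G := [set: gT]%G.
Local Notation aG := (regular_repr algC G).

(** Left multiplication by h on the group algebra: it commutes with the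
    regular representation, which acts on the right. *)
Definition lmul_mx (h : gT) : 'M[algC]_#|G| :=
  \matrix_i delta_mx 0 (gring_index G (h * enum_val i)%g).

Lemma gring_rowE (x : gT) : gring_row (aG x) = delta_mx 0 (gring_index G x).
Proof. by rewrite /gring_row rowK gring_indexK ?inE // mul1g. Qed.

Lemma delta_lmul h x :
  delta_mx 0 (gring_index G x) *m lmul_mx h
    = delta_mx 0 (gring_index G (h * x)%g) :> 'rV_#|G|.
Proof. by rewrite -rowE rowK gring_indexK ?inE. Qed.

Lemma lmul_mxM h k : lmul_mx k *m lmul_mx h = lmul_mx (h * k)%g.
Proof.
by apply/row_matrixP=> i; rewrite row_mul !rowK delta_lmul mulgA.
Qed.

Lemma lmul_centg h : centgmx aG (lmul_mx h).
Proof.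
apply/centgmxP=> x Gx; apply/row_matrixP=> i; rewrite !row_mul !rowK.
by rewrite delta_lmul -rowE rowK gring_indexK ?inE // mulgA.
Qed.

Lemma mxtrace_lmul h x :
  \tr (lmul_mx h *m aG x) = \sum_y (h * y * x == y)%g%:R.
Proof.
rewrite (reindex (@enum_val _ (mem G))) /=; last first.
  by apply: onW_bij; exists (gring_index G); [apply: gring_valK | move=> y;
    apply: gring_indexK; rewrite inE].
apply: eq_bigr => i _.
have -> : (lmul_mx h *m aG x) i i = row i (lmul_mx h *m aG x) 0 i
  by rewrite [RHS]mxE.
rewrite row_mul rowK -rowE rowK mxE eqxx /= gring_indexK ?inE //.
by rewrite -(inj_eq (can_inj (@gring_valK _ G))) gring_indexK ?inE // eq_sym.
Qed.

(** If b is additive on H, this is left multiplication by the idempotent of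
    the linear character (-1)^b of H. *)
Definition lin_idem (H : {set gT}) b : 'M[algC]_#|G| :=
  #|H|%:R^-1 *: \sum_(h in H) (-1) ^+ b h *: lmul_mx h.

Lemma lin_idem_centg (H : {set gT}) b : centgmx aG (lin_idem H b).
Proof.
apply/centgmxP=> x Gx; rewrite -scalemxAl -scalemxAr; congr (_ *: _).
rewrite mulmx_suml mulmx_sumr; apply: eq_bigr => h _.
by rewrite -scalemxAl -scalemxAr (centgmxP (lmul_centg h)).
Qed.

Lemma lin_idemM H K b bK :
    {in H &, forall x y, b (x * y)%g = b x (+) b y} -> K \subset H ->
    {in K, b =1 bK} ->
  lin_idem H b *m lin_idem K bK = lin_idem H b /\
  lin_idem K bK *m lin_idem H b = lin_idem H b.
Proof.
move=> bM sKH bE; pose L := \sum_(h in H) (-1) ^+ b h *: lmul_mx h.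
have Ll k : k \in K -> L *m lmul_mx k = (-1) ^+ bK k *: L.
  move=> Kk; have Hk := subsetP sKH k Kk; rewrite /L mulmx_suml.
  rewrite scaler_sumr [RHS](reindex_inj (mulgI k)) /=; apply: eq_big => h.
    by rewrite groupMl.
  move=> Hh; rewrite -scalemxAl lmul_mxM scalerA bM // (bE k) // -signr_addb.
  by rewrite addKb.
have Lr k : k \in K -> lmul_mx k *m L = (-1) ^+ bK k *: L.
  move=> Kk; have Hk := subsetP sKH k Kk; rewrite /L mulmx_sumr.
  rewrite scaler_sumr [RHS](reindex_inj (mulIg k)) /=; apply: eq_big => h.
    by rewrite groupMr.
  move=> Hh; rewrite -scalemxAr lmul_mxM scalerA bM // (bE k) // -signr_addb.
  by rewrite addbC addbK.
have nzK : #|K|%:R != 0 :> algC by rewrite pnatr_eq0 -lt0n cardG_gt0.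
have -> : lin_idem H b = #|H|%:R^-1 *: L by [].
clearbody L; rewrite /lin_idem -!scalemxAl -!scalemxAr mulmx_suml mulmx_sumr.
split.
  congr (_ *: _); rewrite (eq_bigr (fun _ => L)) => [|k Kk]; last first.
    by rewrite -scalemxAr Ll // scalerA -expr2 sqrr_sign scale1r.
  by rewrite sumr_const -scaler_nat scalerA mulVf ?scale1r.
rewrite scalerA mulrC -scalerA; congr (_ *: _).
rewrite (eq_bigr (fun _ => L)) => [|k Kk]; last first.
  by rewrite -scalemxAl Lr // scalerA -expr2 sqrr_sign scale1r.
by rewrite sumr_const -scaler_nat scalerA mulVf ?scale1r.
Qed.

(** If b is additive on H, this is the character induced from the linear
    character (-1)^b of H, realised on the right ideal generated by its
    idempotent. Induced characters appear in this form because Young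
    symmetrizers are products of two such idempotents. *)
Definition indlin (H : {set gT}) b : 'CF(G) :=
  cfRepr (submod_repr (centgmx_module (lin_idem_centg H b))).

Lemma indlin_char (H : {set gT}) b : indlin H b \is a character.
Proof. exact: cfRepr_char. Qed.

Lemma indlin_trace H b x :
    {in H &, forall x y, b (x * y)%g = b x (+) b y} ->
  indlin H b x = \tr (lin_idem H b *m aG x).
Proof.
move=> bM; rewrite cfunE inE mulr1n; apply: mxtrace_submod_idem => //.
by case: (lin_idemM bM (subxx H) (fun _ _ => erefl)).
Qed.

Lemma indlinE H b x :
    {in H &, forall x y, b (x * y)%g = b x (+) b y} ->
  indlin H b x = #|H|%:R^-1 *
    \sum_y (if (x ^ y)%g \in H then (-1) ^+ b (x ^ y)%g else 0).
Proof.
move=> bM; rewrite indlin_trace // -scalemxAl linearZ /=; congr (_ * _).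
rewrite mulmx_suml linear_sum /=.
rewrite (eq_bigr (fun h => \sum_y (-1) ^+ b h *+ (h * y * x == y)%g));
  last first.
  move=> h _; rewrite -scalemxAl linearZ /= mxtrace_lmul mulr_sumr.
  by apply: eq_bigr => y _; rewrite mulr_natr.
rewrite exchange_big (reindex_inj invg_inj) /=; apply: eq_bigr => y _.
have b1 : b 1%g = false by have := bM _ _ (group1 H) (group1 H);
  rewrite mulg1 addbb.
have bV h : h \in H -> b h^-1%g = b h.
  move=> Hh; have := bM _ _ Hh (groupVr Hh); rewrite mulgV b1.
  by case: (b h); case: (b _).
have eqh h : (h * y^-1 * x == y^-1)%g = (h == (x ^ y)^-1)%g.
  rewrite -(inj_eq (mulIg (x^-1 * y)%g)) mulgA mulgK mulgKV -conjVg.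
  by rewrite conjgE.
have [Hxy|Hxy] := ifP; last first.
  rewrite big1 // => h Hh; rewrite eqh; case: eqP => // Dh.
  by rewrite Dh groupV Hxy in Hh.
rewrite (bigD1 (x ^ y)^-1%g) ?groupV //= eqh eqxx bV // big1 ?addr0 // =>
  h /andP[_].
by rewrite eqh => /negPf->.
Qed.

(** Inducing the restriction of a linear character from a smaller subgroup
    gives a larger character; in the group algebra, one idempotent absorbs the
    other. *)
Lemma indlin_sub H K b bK :
    {in H &, forall x y, b (x * y)%g = b x (+) b y} -> K \subset H ->
    {in K, b =1 bK} ->
  indlin K bK - indlin H b \is a character.
Proof.
move=> bM sKH bE; have [HK KH] := lin_idemM bM sKH bE.
have bKM : {in K &, forall x y, bK (x * y)%g = bK x (+) bK y}.
  move=> x y Kx Ky; rewrite -!bE ?groupM //.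
  by apply: bM; apply: (subsetP sKH).
apply: (idem_sub_char (lin_idem_centg _ _) (lin_idem_centg _ _) _ _ KH HK).
- by case: (lin_idemM bKM (subxx K) (fun _ _ => erefl)).
- by case: (lin_idemM bM (subxx H) (fun _ _ => erefl)).
- by move=> x _; apply: indlin_trace.
by move=> x _; apply: indlin_trace.
Qed.

Definition symmetrizer (R C : {set gT}) b : 'rV[algC]_#|G| :=
  \sum_(r in R) \sum_(c in C) (-1) ^+ b c *: gring_row (aG (r * c)%g).

(** Left multiplications compose in reverse order, so that the idempotent of
    the signed sum over C is applied first. *)
Lemma symmetrizerE R C b :
  symmetrizer R C b = (#|R|%:R * #|C|%:R) *:
    (gring_row 1%:M *m (lin_idem C b *m lin_idem R xpred0)).
Proof.
have nz H : #|H|%:R != 0 :> algC by rewrite pnatr_eq0 -lt0n cardG_gt0.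
rewrite /lin_idem -!scalemxAl -!scalemxAr !scalerA.
rewrite mulrA mulfK // divff // scale1r.
rewrite /symmetrizer exchange_big mulmx_suml mulmx_sumr; apply: eq_bigr => c Cc.
rewrite mulmx_sumr mulmx_sumr; apply: eq_bigr => r Rr.
rewrite -scalemxAl -!scalemxAr scale1r; congr (_ *: _).
rewrite lmul_mxM -(repr_mx1 aG) !gring_rowE delta_lmul.
by rewrite mulg1.
Qed.

(** The identity occurs in it only as the product of two identities. *)
Lemma symmetrizer_neq0 R C b : R :&: C = 1%g ->
  {in C &, forall x y, b (x * y)%g = b x (+) b y} -> symmetrizer R C b != 0.
Proof.
move=> tiRC bM; apply/eqP=> /matrixP/(_ 0 (gring_index G 1%g)).
have b1 : b 1%g = false by have := bM _ _ (group1 C) (group1 C);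
  rewrite mulg1 addbb.
have E x : gring_row (aG x) 0 (gring_index G 1%g) = (x == 1%g)%:R.
  rewrite gring_rowE mxE eqxx /= -(inj_eq (can_inj (@gring_valK _ G))).
  by rewrite !gring_indexK ?inE // eq_sym.
rewrite summxE (bigD1 1%g) ?group1 //= summxE (bigD1 1%g) ?group1 //=.
rewrite mxE E mulg1 eqxx b1 mulr1 big1 => [|c /andP[Cc nc]]; last first.
  by rewrite mxE E mul1g (negPf nc) mulr0.
rewrite big1 => [|r /andP[Rr nr]]; last first.
  rewrite summxE big1 // => c Cc; rewrite mxE E; case: eqP => [rc1|]; last
    by rewrite mulr0.
  have Dr : r = c^-1%g by apply/eqP; rewrite eq_mulgV1 invgK rc1.
  have : r \in R :&: C by rewrite inE Rr Dr groupV.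
  by rewrite tiRC inE (negPf nr).
by rewrite !addr0 mxE => /eqP; rewrite oner_eq0.
Qed.

Lemma symmetrizer_char R C b :
    {in C &, forall x y, b (x * y)%g = b x (+) b y} -> R :&: C = 1%g ->
    '[indlin R xpred0, indlin C b] = 1 ->
  let chi := cfRepr (submod_repr (cyclic_mx_module aG (symmetrizer R C b))) in
  chi \in irr G /\
  (forall i, '[indlin R xpred0, 'chi_i] != 0 -> '[indlin C b, 'chi_i] != 0 ->
     'chi_i = chi).
Proof.
move=> bM tiRC dot1; set U := cyclic_mx aG _; set modU := cyclic_mx_module aG _.
have bR : {in R &, forall x y, xpred0 (x * y)%g = xpred0 x (+) xpred0 y} by [].
have nz H : #|H|%:R != 0 :> algC by rewrite pnatr_eq0 -lt0n cardG_gt0.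
have cP := lin_idem_centg R xpred0; have cQ := lin_idem_centg C b.
have eqU : (U :=: lin_idem C b *m lin_idem R xpred0)%MS.
  have cQP := centgmxM cQ cP; set Z := _ *m _ in cQP *.
  have De : symmetrizer R C b = (#|R|%:R * #|C|%:R) *: (gring_row 1%:M *m Z).
    exact: symmetrizerE.
  apply/eqmxP/andP; split.
    apply: cyclic_mx_sub; first exact: centgmx_module.
    by rewrite De scalemx_sub // submxMl.
  apply/row_subP=> i.
  have -> : row i Z = (#|R|%:R * #|C|%:R)^-1 *:
      (symmetrizer R C b *m aG (enum_val i)).
    rewrite De -scalemxAl scalerA mulVf ?mulf_neq0 // scale1r -mulmxA.
    rewrite (centgmxP cQP) ?inE // mulmxA -gring_row_mul mul1mx gring_rowE.
    by rewrite gring_valK -rowE.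
  apply: scalemx_sub; apply: mxmodule_trans modU _ _; first by rewrite inE.
  exact: cyclic_mx_id.
have [_ idP] := lin_idemM bR (subxx R) (fun _ _ => erefl).
have [_ idQ] := lin_idemM bM (subxx C) (fun _ _ => erefl).
have [Cphi Cpsi] := idem_mul_char modU cP cQ idP idQ eqU
  (fun x _ => indlin_trace x bR) (fun x _ => indlin_trace x bM).
apply: irr_of_cfdot1 Cphi Cpsi dot1 => //; try exact: cfRepr_char.
have nzU : U != 0 by rewrite cyclic_mx_eq0 symmetrizer_neq0.
apply: contraNneq nzU => /cfunP/(_ 1%g); rewrite cfRepr1 cfunE => /eqP.
by rewrite pnatr_eq0 mxrank_eq0.
Qed.

End InducedLinear.

(** * Words, Young subgroups and Mackey's formula *)

Section RestrictedSign.

Variable T : finType.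
Implicit Types (s t : {perm T}) (B D E : {set T}).

Lemma stab_setP B s : reflect (forall x, (s x \in B)
  = (x \in B)) (s \in ('N(B | 'P))%g).
Proof. by apply: (iffP astabsP) => nBs x; apply: nBs. Qed.

(** A cycle of length c has sign -(-1)^c. *)
Lemma sign_perm_porbits t :
  (-1) ^+ t = \prod_(X in porbits t) - (-1) ^+ #|X| :> algC.
Proof.
rewrite prodrN prodrXr -(_ : #|T| = \sum_(X in porbits t) #|X|)%N.
  by rewrite -exprD -[RHS]signr_odd oddD addbC.
rewrite -sum1_card (partition_big (porbit t) (mem (porbits t))) /= => [|x _];
  last first.
  exact: imset_f.
apply: eq_bigr => _ /imsetP[y _ ->]; rewrite -sum1_card; apply: eq_bigl => x.
by rewrite eq_porbit_mem.
Qed.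

Lemma porbit_restr B s x : s \in ('N(B | 'P))%g ->
  porbit (restr_perm B s) x = if x \in B then porbit s x else [set x].
Proof.
move=> nBs; have sB i y : y \in B ->
  (s ^+ i)%g y \in B /\ (restr_perm B s ^+ i)%g y = (s ^+ i)%g y.
  move=> By; elim: i => [|i [IHi IHe]]; first by rewrite !expg0 !perm1.
  rewrite !expgSr !permM; split; first by rewrite (stab_setP _ _ nBs).
  by rewrite IHe restr_permE.
case: ifP => Bx; apply/setP=> y.
  by apply/porbitP/porbitP=> -[i ->]; exists i; case: (sB i x Bx).
rewrite inE; apply/porbitP/eqP => [[i ->]|->]; last
  by exists 0%N; rewrite expg0 perm1.
elim: i => [|i IHi]; first by rewrite expg0 perm1.
by rewrite expgSr permM IHi (out_perm (restr_perm_on _ _)) ?Bx.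
Qed.

Lemma sign_restr_perm B s : s \in ('N(B | 'P))%g ->
  (-1) ^+ restr_perm B s
    = \prod_(X in porbits s | X \subset B) - (-1) ^+ #|X| :> algC.
Proof.
move=> nBs; rewrite sign_perm_porbits (bigID (fun X : {set T} =>
  X \subset B)) /=.
rewrite [X in _ * X]big1 ?mulr1 => [|X /andP[/imsetP[x _ ->]]]; last first.
  rewrite porbit_restr //; case: ifP => Bx; last by rewrite cards1 expr1 opprK.
  case/subsetP=> y /porbitP[i ->]; elim: i => [|i IHi]; first
    by rewrite expg0 perm1.
  by rewrite expgSr permM (stab_setP _ _ nBs).
apply: eq_bigl => X; apply: andb_id2r => sXB.
apply/imsetP/imsetP=> -[x _ DX]; exists x => //.
  move: DX; rewrite porbit_restr //; case: ifP => // Bx DX.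
  by have := subsetP sXB x; rewrite DX set11 Bx => /(_ isT).
by rewrite porbit_restr // (subsetP sXB) // DX porbit_id.
Qed.

Lemma sub_porbitE B s X x : s \in ('N(B | 'P))%g -> X \in porbits s ->
  x \in X ->
  (X \subset B) = (x \in B).
Proof.
move=> nBs /imsetP[y _ ->]; rewrite -eq_porbit_mem => /eqP <-.
apply/subsetP/idP=> [-> //|Bx z /porbitP[i ->]]; first exact: porbit_id.
elim: i => [|i IHi]; first by rewrite expg0 perm1.
by rewrite expgSr permM (stab_setP _ _ nBs).
Qed.

(** Cycles lying in both sets contribute the square of a sign. *)
Lemma sign_restr_symdiff B D E s :
    s \in ('N(B | 'P))%g -> s \in ('N(D | 'P))%g ->
    (forall x, (x \in E) = (x \in B) (+) (x \in D)) ->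
  (-1) ^+ restr_perm B s * (-1) ^+ restr_perm D s = (-1) ^+ restr_perm E s
    :> algC.
Proof.
move=> nBs nDs EE; have nEs : s \in ('N(E | 'P))%g.
  by apply/stab_setP=> x; rewrite !EE (stab_setP _ _ nBs) (stab_setP _ _ nDs).
rewrite !sign_restr_perm // !big_mkcondr -big_split; apply: eq_bigr => X sX /=.
have [x Xx] : exists x, x \in X by case/imsetP: sX => x _ ->; exists x;
  apply: porbit_id.
rewrite !(sub_porbitE _ sX Xx) // EE.
case: (x \in B); case: (x \in D); rewrite ?mulr1 ?mul1r //.
by rewrite mulrNN -expr2 sqrr_sign.
Qed.

End RestrictedSign.

Section Words.

Variables (n : nat) (T : finType).
Local Notation word := {ffun 'I_n -> T}.
Implicit Types (F : word) (e : pred T) (s y : 'S_n).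

(** The symmetric group acts on words by permuting positions; the stabilisers
    are the Young subgroups. *)
Definition word_stab F : {set 'S_n} := [set s :
  'S_n | [forall i, F (s i) == F i]].

Lemma word_stabP F s : reflect (forall i, F (s i) = F i) (s \in word_stab F).
Proof. by rewrite inE; apply: (iffP forallP) => H i; apply/eqP. Qed.

Lemma word_stab_group_set F : group_set (word_stab F).
Proof.
apply/group_setP; split=> [|s t /word_stabP Fs /word_stabP Ft].
  by apply/word_stabP=> i; rewrite perm1.
by apply/word_stabP=> i; rewrite permM Ft Fs.
Qed.
Canonical word_stab_group F := Group (word_stab_group_set F).

Definition marked e F : {set 'I_n} := [set i | e (F i)].

(** This describes the linear character of the stabiliser of F that is the
    sign on the blocks of the letters selected by e and trivial on the other
    blocks. *)
Definition word_parity e F s : bool := restr_perm (marked e F) s.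

Lemma word_stab_marked e F s : s \in word_stab F ->
  s \in ('N(marked e F | 'P))%g.
Proof. by move/word_stabP=> Fs; apply/stab_setP=> i; rewrite !inE Fs. Qed.

Lemma word_parityM e F :
  {in word_stab F &, forall s t, word_parity e F (s * t)%g
    = word_parity e F s (+) word_parity e F t}.
Proof.
move=> s t Fs Ft; rewrite /word_parity morphM ?word_stab_marked //.
by rewrite odd_permM.
Qed.

Definition word_sign e F s : algC :=
  if s \in word_stab F then (-1) ^+ word_parity e F s else 0.

Definition content F : {ffun T -> 'I_n.+1} :=
  [ffun a => inord #|[set i | F i == a]|].

Lemma contentE F a : content F a = #|[set i | F i == a]| :> nat.
Proof.
by rewrite ffunE inordK // ltnS -[X in (_ <= X)%N](card_ord n) max_card.
Qed.

Definition word_act F s : word := [ffun i => F (s i)].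

Lemma content_act F s : content (word_act F s) = content F.
Proof.
apply/ffunP=> a; apply/val_inj; rewrite /= !contentE.
rewrite -(card_imset [set i | F i == a] (@perm_inj _ s^-1)%g);
  congr #|pred_of_set _|.
apply/setP=> i; rewrite inE ffunE; apply/idP/imsetP=> [Fsi|[j]].
  by exists (s i); rewrite ?inE ?permK.
by rewrite inE => Fj ->; rewrite permKV.
Qed.

(** Words with the same content form one orbit. *)
Lemma content_eq_act F F' : content F = content F' ->
  exists s, F' = word_act F s.
Proof.
(* Equal contents mean that the two sequences of letters are permutations of
   each other. *)
move=> eqc; pose tup (H : word) := [tuple H i | i < n].
have /tuple_permP[s Ds] : perm_eq (tup F') (tup F).
  apply/allP=> a _; apply/eqP.
  have count_content (H : word) : count_mem a (tup H) = content H a.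
    rewrite contentE /= count_map -size_filter cardE enumT /enum_mem.
    by congr size; apply: eq_filter => i; rewrite /= inE.
  by rewrite !count_content eqc.
exists s; apply/ffunP=> i; rewrite ffunE.
have {Ds} /(congr1 (fun t => tnth t i)) := val_inj Ds.
by rewrite !tnth_mktuple.
Qed.

Lemma word_act_eqE F s t :
  (word_act F s == word_act F t) = (t \in s *: word_stab F)%g.
Proof.
rewrite mem_lcoset; apply/eqP/word_stabP=> [/ffunP eqF i|Fst].
  by have := eqF (s^-1 i)%g; rewrite !ffunE permM permKV => ->.
by apply/ffunP=> i; rewrite !ffunE -(Fst (s i)) permM permK.
Qed.

Lemma sum_word_act F (phi : word -> algC) :
  \sum_s phi (word_act F s)
    = #|word_stab F|%:R * \sum_(F' | content F' == content F) phi F'.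
Proof.
rewrite (partition_big (word_act F) (fun F' => content F' == content F)) /=;
  last first.
  by move=> s _; rewrite content_act.
rewrite mulr_sumr; apply: eq_bigr => F' /eqP eqc.
have [t ->] := content_eq_act (esym eqc).
rewrite (eq_bigl (fun s => s \in t *: word_stab F)%g) => [|s]; last
  by rewrite eq_sym word_act_eqE.
rewrite (eq_bigr (fun _ => phi (word_act F t))) => [|s].
  by rewrite sumr_const card_lcoset mulr_natl.
by rewrite -word_act_eqE => /eqP <-.
Qed.

Lemma word_sign_act e F s y : word_sign e (word_act F y) s
  = word_sign e F (s ^ y).
Proof.
have yE i : y ((s : 'S_n) i) = (s ^ y)%g (y i) by rewrite conjgE !permM permK.
have stabE : (s \in word_stab (word_act F y)) = ((s ^ y)%g \in word_stab F).
  apply/word_stabP/word_stabP=> Fs i.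
    by have := Fs (y^-1 i)%g; rewrite !ffunE yE permKV.
  by rewrite !ffunE yE Fs.
rewrite /word_sign stabE; case: ifP => // Fsy.
have nBs := word_stab_marked e Fsy.
have nBs' : s \in ('N(marked e (word_act F y) | 'P))%g.
  by apply: word_stab_marked; rewrite stabE.
rewrite /word_parity -[in LHS](odd_permJ _ y); congr (_ ^+ odd_perm _).
apply/permP=> i; rewrite conjgE !permM.
have Bi : (i \in marked e F) = ((y^-1)%g i \in marked e (word_act F y)).
  by rewrite !inE ffunE permKV.
have [iB|iB] := boolP (i \in marked e F).
  by rewrite !restr_permE -?Bi // yE permKV.
by rewrite !(out_perm (restr_perm_on _ _)) -?Bi // permKV.
Qed.

Definition word_char e F : 'CF([set: 'S_n]) :=
  indlin (word_stab F) (word_parity e F).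

(** Summing over conjugates of the stabiliser amounts to summing over the
    orbit of F, that is, over the words of the same content. *)
Lemma word_charE e F s :
  word_char e F s = \sum_(F' | content F' == content F) word_sign e F' s.
Proof.
rewrite indlinE; last exact: word_parityM.
rewrite -[LHS]/(_ * \sum_y word_sign e F (s ^ y)%g).
under eq_bigr do rewrite -word_sign_act.
rewrite (sum_word_act F (fun F' => word_sign e F' s)) mulKf //.
by rewrite pnatr_eq0 -lt0n cardG_gt0.
Qed.

Lemma restr_perm_tperm (B : {set 'I_n}) (x y : 'I_n) :
  x \in B -> y \in B -> restr_perm B (tperm x y) = tperm x y.
Proof.
move=> Bx By; apply/permP=> z; have nB : tperm x y \in ('N(B | 'P))%g.
  by apply/stab_setP=> u; case: tpermP => [->|->|]; rewrite ?Bx ?By.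
have [Bz|Bz] := boolP (z \in B); first by rewrite restr_permE.
rewrite (out_perm (restr_perm_on _ _)) // tpermD //.
  by apply: contraNneq Bz => <-.
by apply: contraNneq Bz => <-.
Qed.

(** If a selected letter occurs twice, the transposition of two of its
    positions stabilises F and is odd, so the signs cancel; otherwise the
    stabiliser fixes all selected positions. *)
Lemma sum_word_sign e F :
  \sum_s word_sign e F s =
    #|word_stab F|%:R *+ [forall a, e a ==> (content F a <= 1)%N].
Proof.
case: (boolP [forall a, e a ==> (content F a <= 1)%N]) => [/forallP inj|].
  rewrite mulr1n -sum1_card natr_sum [RHS]big_mkcond; apply: eq_bigr => s _.
  rewrite /word_sign; case: ifP => // Fs; rewrite /word_parity.
  suff -> : restr_perm (marked e F) s = 1%g by rewrite odd_perm1.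
  apply/permP=> i; rewrite perm1.
  have [Bi|Bi] := boolP (i \in marked e F);
    last exact: (out_perm (restr_perm_on _ _)).
  rewrite restr_permE ?word_stab_marked //.
  have := inj (F i); rewrite inE in Bi;
    rewrite Bi contentE /= => /card_le1_eqP; apply;
    by rewrite inE ?(word_stabP _ _ Fs).
rewrite negb_forall => /existsP[a];
  rewrite negb_imply -ltnNge contentE => /andP[ea].
case/card_gt1P=> x [y []]; rewrite !inE => /eqP Fx /eqP Fy neq_xy.
set t := tperm x y; have Ft : t \in word_stab F.
  by apply/word_stabP=> z; rewrite /t; case: tpermP => [->|->|];
    rewrite ?Fx ?Fy.
(* The sum equals its opposite under right multiplication by t. *)
apply/eqP; rewrite mulr0n -eqNr; apply/eqP.
rewrite [RHS](reindex_inj (mulIg t)) /= -sumrN; apply: eq_bigr => s _.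
rewrite /word_sign groupMr //; case: ifP => [Fs|]; last by rewrite oppr0.
rewrite word_parityM // {3}/word_parity restr_perm_tperm ?inE ?Fx ?Fy //.
by rewrite odd_tperm neq_xy signr_addb mulrN1.
Qed.

(** Orbit-stabiliser: each orbit contributes the order of the group. *)
Lemma sum_content_stab (c : {ffun T -> 'I_n.+1}) :
  \sum_(F | content F == c) #|word_stab F|%:R
    = n`!%:R *+ [exists F, content F == c] :> algC.
Proof.
case: (boolP [exists F, content F == c]) => [/existsP[F0 /eqP <-{c}]|];
  last first.
  rewrite negb_exists => /forallP nF; rewrite big1 // => F FC.
  by rewrite (negPf (nF F)) in FC.
rewrite mulr1n; set m := #|[pred F | content F == content F0]|.
have stabE F : content F == content F0 -> #|word_stab F|%:R = n`!%:R / m%:R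
  :> algC.
  move=> /eqP eqF; have := sum_word_act F (fun=> 1);
    rewrite !sumr_const card_Sn eqF => ->.
  rewrite mulfK // pnatr_eq0 -lt0n; apply/card_gt0P; exists F0.
  exact: eqxx.
rewrite (eq_bigr _ stabE) sumr_const -[LHS]mulr_natr mulfVK //.
by rewrite pnatr_eq0 -lt0n; apply/card_gt0P; exists F0; apply: eqxx.
Qed.

End Words.

Section Mackey.

Variables (n : nat) (T T' : finType).
Implicit Types (F : {ffun 'I_n -> T}) (H : {ffun 'I_n -> T'}).
Implicit Types (Z : {ffun 'I_n -> T * T'}) (e : pred T) (d : pred T').

Definition word_fst Z : {ffun 'I_n -> T} := [ffun i => (Z i).1].
Definition word_snd Z : {ffun 'I_n -> T'} := [ffun i => (Z i).2].
Definition word_pair F H : {ffun 'I_n -> T * T'} := [ffun i => (F i, H i)].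

Lemma word_pairK Z : word_pair (word_fst Z) (word_snd Z) = Z.
Proof. by apply/ffunP=> i; rewrite !ffunE -surjective_pairing. Qed.

Lemma word_fst_pair F H : word_fst (word_pair F H) = F.
Proof. by apply/ffunP=> i; rewrite !ffunE. Qed.

Lemma word_snd_pair F H : word_snd (word_pair F H) = H.
Proof. by apply/ffunP=> i; rewrite !ffunE. Qed.

Lemma content_fst Z a : content (word_fst Z) a
  = (\sum_b content Z (a, b))%N :> nat.
Proof.
rewrite contentE -sum1_card (partition_big (fun i => (Z i).2) predT) //=.
apply: eq_bigr => b _; rewrite contentE -sum1_card; apply: eq_bigl => i.
by rewrite !inE ffunE; case: (Z i).
Qed.

Lemma content_snd Z b : content (word_snd Z) b
  = (\sum_a content Z (a, b))%N :> nat.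
Proof.
rewrite contentE -sum1_card (partition_big (fun i => (Z i).1) predT) //=.
apply: eq_bigr => a _; rewrite contentE -sum1_card; apply: eq_bigl => i.
by rewrite !inE ffunE; case: (Z i) => u v; rewrite xpair_eqE andbC.
Qed.

(** A pair of letters is mixed if just one of the two linear characters has a
    sign there: then the product of the two signs on the common block is a
    sign. *)
Definition mixed e d : pred (T * T') := fun p => e p.1 (+) d p.2.

Lemma word_signM e d F H s :
  word_sign e F s * word_sign d H s = word_sign (mixed e d) (word_pair F H) s.
Proof.
rewrite /word_sign.
have -> : (s \in word_stab (word_pair F H))
  = (s \in word_stab F) && (s \in word_stab H).
  apply/word_stabP/andP=> [st|[/word_stabP st /word_stabP st'] i].
    by split; apply/word_stabP=> i; have := st i; rewrite !ffunE => -[].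
  by rewrite !ffunE st st'.
case: ifP => [Fs|_]; last by rewrite mul0r.
case: ifP => [Hs|_]; last by rewrite mulr0.
apply: sign_restr_symdiff; try exact: word_stab_marked.
by move=> i; rewrite !inE ffunE.
Qed.

(** These matrices parametrise the double cosets of the two Young subgroups on
    which the two linear characters agree. *)
Definition joint_contents e d F H : {set {ffun T * T' -> 'I_n.+1}} :=
  [set c | [exists Z, [&& content Z == c, content (word_fst Z) == content F
                        & content (word_snd Z) == content H]]
           && [forall p, mixed e d p ==> (c p <= 1)%N]].

(** Mackey's formula: pairs of words are words in pairs of letters, whose
    orbits are given by contents, and an orbit contributes 1 or 0 according to
    sum_word_sign. *)
Lemma word_char_cfdot e d F H :
  '[word_char e F, word_char d H] = #|joint_contents e d F H|%:R.
Proof.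
have realS s : (word_char d H s)^* = word_char d H s.
  apply: CrealP; rewrite word_charE rpred_sum // => u _.
  by rewrite /word_sign; case: ifP => _; rewrite ?rpred0 // rpred_sign.
rewrite cfdotE (eq_bigr (fun s => \sum_(Z : {ffun 'I_n -> T * T'} |
     (content (word_fst Z) == content F) && (content (word_snd Z) == content H))
       word_sign (mixed e d) Z s)) => [|s _]; last first.
  rewrite realS !word_charE big_distrlr /=.
  rewrite pair_big /= (reindex (fun Z => (word_fst Z, word_snd Z))) /=.
    by apply: eq_bigr => Z _; rewrite word_signM word_pairK.
  exists (fun p => word_pair p.1 p.2) => [Z|[u v]] _ /=;
    first exact: word_pairK.
  by rewrite word_fst_pair word_snd_pair.
rewrite exchange_big /=.
rewrite (eq_bigr (fun Z => #|word_stab Z|%:R *+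
    [forall p, mixed e d p ==> (content Z p <= 1)%N])) => [|Z _]; last first.
  rewrite -sum_word_sign; apply: eq_bigl => s; first by rewrite inE.
rewrite cardsT card_Sn.
pose P Z := (content (word_fst Z) == content F) && (content (word_snd Z) ==
  content H).
pose J := joint_contents e d F H.
rewrite (bigID (fun Z => content Z \in J)) /= [X in _ + X]big1 ?addr0;
  last first.
  move=> Z /andP[/andP[FZ HZ]]; rewrite inE negb_and => /orP[|/negPf-> //].
  by rewrite negb_exists => /forallP/(_ Z); rewrite eqxx FZ HZ.
have JP Z : content Z \in J -> P Z.
  rewrite inE => /andP[/existsP[Z' /and3P[/eqP eqZ FZ HZ]] _].
  have [s Ds] := content_eq_act eqZ.
  have E1 : word_fst Z = word_act (word_fst Z') s
    by apply/ffunP=> i; rewrite Ds !ffunE.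
  have E2 : word_snd Z = word_act (word_snd Z') s
    by apply/ffunP=> i; rewrite Ds !ffunE.
  by rewrite /P E1 E2 !content_act FZ HZ.
rewrite (eq_bigl (fun Z => content Z \in J)); last first.
  by move=> Z; rewrite andbC; apply: andb_idr => /JP.
rewrite (partition_big (@content n _) (mem J)) //=.
rewrite (eq_bigr (fun=> n`!%:R)) => [|c Jc].
  by rewrite sumr_const -[X in _ * X]mulr_natl mulrC mulfK // pnatr_eq0 -lt0n
    fact_gt0.
have := Jc; rewrite inE => /andP[/existsP[Z0 /and3P[eqZ0 _ _]] inj].
transitivity (\sum_(Z : {ffun 'I_n ->
  T * T'} | content Z == c) #|word_stab Z|%:R : algC).
  apply: eq_big => [Z|Z /andP[_ /eqP->]]; last by rewrite inj.
  by rewrite andbC; apply: andb_idr => /eqP->.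
by rewrite sum_content_stab (introT existsP) //; exists Z0.
Qed.

End Mackey.

(** * Orthonormality of the Jacobi-Trudi determinants *)

Section SignReversing.

Variables (l N : nat) (la : 'I_l -> nat).
Hypothesis la_decr : forall i j : 'I_l, (i <= j)%N -> (la j <= la i)%N.
Hypothesis la_sum : (\sum_i la i = N)%N.

Local Notation mat := {ffun 'I_l * 'I_l -> 'I_N.+1}.
Implicit Types (w : 'S_l) (M : mat) (i j k : 'I_l).

(** The row sums are the indices la i - i + w i of a term of a Jacobi-Trudi
    determinant; without subtraction, the condition fails when one of them is
    negative. *)
Definition rows_ok w M := [forall i, (\sum_k M (i, k) + i == la i + w i)%N].
Definition cols_ok w M := [forall k, (\sum_i M (i, k) + k == la k + w k)%N].

(** With row i labelled w i, the columns before k are upper triangular. *)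
Definition cleared w M (k : nat) :=
  [forall i, [forall k' : 'I_l, (k' < k)%N && (k' < w i)%N ==> (M (i,
    k') == 0 :> nat)]].

(** Reading row i as the row labelled w i, column k is the first one with a
    nonzero entry in a row of label larger than the index of the column, and j
    is the largest label of such a row. *)
Definition pivot k j w M :=
  [&& (k < j)%N, (0 < M ((w^-1)%g j, k))%N,
      [forall i, (j < w i)%N ==> (M (i, k) == 0 :> nat)] & cleared w M k].

Lemma clearedP w M (k : nat) :
  reflect (forall i (k' : 'I_l), (k' < k)%N -> (k' < w i)%N ->
    M (i, k') = 0 :> nat) (cleared w M k).
Proof.
apply: (iffP forallP) => [H i k' ltk ltw|H i].
  by have /forallP/(_ k') := H i; rewrite ltk ltw => /eqP.
by apply/forallP=> k'; apply/implyP=> /andP[ltk ltw]; rewrite H.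
Qed.

Lemma pivotP k j w M :
  reflect [/\ (k < j)%N, (0 < M ((w^-1)%g j, k))%N,
             forall i, (j < w i)%N -> M (i, k) = 0
               :> nat & cleared w M k] (pivot k j w M).
Proof.
apply: (iffP and4P) => [[? ? /forallP H ?]|[? ? H ?]]; split=> //.
  by move=> i lt; have := H i; rewrite lt => /eqP.
by apply/forallP=> i; apply/implyP=> lt; rewrite H.
Qed.

Lemma pivot_uniq k j k' j' w M :
  pivot k j w M -> pivot k' j' w M -> (k, j) = (k', j').
Proof.
wlog lekk' : k j k' j' / (k <= k')%N.
  by move=> IH p p'; case/orP: (leq_total k k') => le; [|symmetry]; apply: IH.
case/pivotP=> ltkj M0 Hj _ /pivotP[ltkj' M0' Hj' /clearedP low'].
have ek : k = k'.
  apply/eqP; rewrite -val_eqE eqn_leq lekk' leqNgt; apply/negP=> ltkk'.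
  by rewrite low' ?permKV in M0.
subst k'; suff ej : j = j' by rewrite ej.
have [lt|lt|/val_inj //] := ltngtP (j : nat) j'.
  by rewrite Hj ?permKV in M0'.
by rewrite Hj' ?permKV in M0.
Qed.

Lemma pivot_exists w M : ~~ cleared w M l -> exists k, exists j, pivot k j w M.
Proof.
rewrite negb_forall => /existsP[i0]; rewrite negb_forall => /existsP[k0].
rewrite negb_imply -lt0n => /andP[/andP[_ ltw0] M0].
pose bad k := [exists i, (k < w i)%N && (0 < M (i, k))%N].
have bad0 : bad k0 by apply/existsP; exists i0; rewrite ltw0.
case: (arg_minnP (fun k : 'I_l => k : nat) bad0) => k badk mink.
have /existsP[i1 i1P] := badk.
pose Q j := (k < j)%N && (0 < M ((w^-1)%g j, k))%N.
have Q1 : Q (w i1) by rewrite /Q permK.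
case: (arg_maxnP (fun j : 'I_l => j : nat) Q1) => j /andP[ltkj Mj] maxj.
exists k, j; apply/pivotP; split=> //.
  move=> i ltj; apply/eqP; rewrite -leqn0 leqNgt; apply/negP=> Mi.
  have := maxj (w i); rewrite /Q permK Mi (ltn_trans ltkj ltj) => /(_ isT) /=.
  by rewrite /= leqNgt ltj.
apply/clearedP=> i k' ltk ltw; apply/eqP; rewrite -leqn0 leqNgt;
  apply/negP=> Mi.
have badk' : bad k' by apply/existsP; exists i; rewrite ltw.
by have := mink k' badk'; rewrite leqNgt ltk.
Qed.

Definition pred_ord j : 'I_l := Ordinal (leq_ltn_trans (leq_pred j) (ltn_ord
  j)).

(** Exchanging the labels j - 1 and j while moving one unit of column k from
    the row formerly labelled j to the other one: this changes the sign of the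
    permutation and keeps all row and column conditions. *)
Definition pivot_step k j (p : 'S_l * mat) : 'S_l * mat :=
  ((p.1 * tperm (pred_ord j) j)%g,
   [ffun q => if q == ((p.1^-1)%g j, k) then inord (p.2 q).-1
              else if q == ((p.1^-1)%g (pred_ord j), k) then inord (p.2 q).+1
              else p.2 q]).

Lemma sum_perm_ord w : (\sum_i (w i : nat) = \sum_(i < l) i)%N.
Proof. by rewrite [RHS](reindex_inj (@perm_inj _ w)). Qed.

Lemma mat_sum w M : rows_ok w M -> (\sum_i \sum_k M (i, k) = N)%N.
Proof.
move/forallP=> rM; apply/eqP; rewrite -(eqn_add2r (\sum_(i < l) i)%N)
  -big_split /=.
rewrite (eq_bigr (fun i => la i + w i)%N) => [|i _]; last exact/eqP.
by rewrite big_split /= la_sum sum_perm_ord.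
Qed.

(** The pivot is at the same place after the step, so the step is an
    involution. *)
Lemma pivot_stepP k j w0 (p : 'S_l * mat) :
    rows_ok p.1 p.2 -> cols_ok w0 p.2 -> pivot k j p.1 p.2 ->
  let q := pivot_step k j p in
  [/\ rows_ok q.1 q.2, cols_ok w0 q.2, pivot k j q.1 q.2 & pivot_step k j q
    = p].
Proof.
case: p => w M /= rM cM /pivotP[ltkj M0 Hj /clearedP lowM].
set jm := pred_ord j; have ejm : jm.+1 = j :> nat
  by rewrite /= prednK // (leq_ltn_trans _ ltkj).
set i1 := (w^-1)%g j; set i2 := (w^-1)%g jm.
have w1 : w i1 = j by rewrite permKV.
have w2 : w i2 = jm by rewrite permKV.
have neqj : jm != j by rewrite -val_eqE /= -ejm neq_ltn leqnn.
have neqi : i1 != i2 by rewrite (inj_eq perm_inj) eq_sym.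
set w' := (w * tperm jm j)%g; set M' := [ffun q => _].
have w'1 : w' i1 = jm by rewrite permM w1 tpermR.
have w'2 : w' i2 = j by rewrite permM w2 tpermL.
have w'3 i : i != i1 -> i != i2 -> w' i = w i.
  move=> n1 n2; rewrite permM tpermD //.
    by apply: contraNneq n2 => e; rewrite -(inj_eq (@perm_inj _ w)) w2 e.
  by apply: contraNneq n1 => e; rewrite -(inj_eq (@perm_inj _ w)) w1 e.
have w'V1 : (w'^-1)%g jm = i1 by rewrite -w'1 permK.
have w'V2 : (w'^-1)%g j = i2 by rewrite -w'2 permK.
have bound : (M (i2, k) < N)%N.
  have leM i : (M (i, k) <= \sum_k' M (i, k'))%N
    by rewrite (bigD1 k) //= leq_addr.
  have lt : (M (i2, k) < \sum_i \sum_k' M (i, k'))%N.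
    rewrite (bigD1 i1) //= [X in (_ < _ + X)%N](bigD1 i2) 1?eq_sym //= addnA.
    by apply: leq_trans (leq_addr _ _);
      rewrite -add1n leq_add // (leq_trans M0).
  by rewrite (mat_sum rM) in lt.
have M'1 : M' (i1, k) = (M (i1, k)).-1 :> nat.
  by rewrite ffunE eqxx inordK // (leq_ltn_trans (leq_pred _)).
have M'2 : M' (i2, k) = (M (i2, k)).+1 :> nat.
  by rewrite ffunE xpair_eqE [i2 == _]eq_sym (negPf neqi) /= eqxx inordK.
have M'3 q : q != (i1, k) -> q != (i2, k) -> M' q = M q.
  by move=> n1 n2; rewrite ffunE (negPf n1) (negPf n2).
have M'k i k' : k' != k -> M' (i, k') = M (i, k').
  by move=> nk; rewrite M'3 // xpair_eqE (negPf nk) andbF.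
have M'i i k' : i != i1 -> i != i2 -> M' (i, k') = M (i, k').
  by move=> n1 n2; rewrite M'3 // xpair_eqE ?(negPf n1) ?(negPf n2).
split.
- have S1 : (\sum_k' M' (i1, k') + 1 = \sum_k' M (i1, k'))%N.
    rewrite (bigD1 k) //= [RHS](bigD1 k) //= M'1.
    rewrite (eq_bigr (fun k' => M (i1, k') : nat)) => [|k' nk]; last
      by rewrite M'k.
    by rewrite addnAC addn1 prednK.
  have S2 : (\sum_k' M' (i2, k') = \sum_k' M (i2, k') + 1)%N.
    rewrite (bigD1 k) //= [in RHS](bigD1 k) //= M'2.
    rewrite (eq_bigr (fun k' => M (i2, k') : nat)) => [|k' nk]; last
      by rewrite M'k.
    by rewrite addnAC addn1.
  apply/forallP=> i; have /forallP/(_ i)/eqP := rM.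
  have [->{i}|n1] := eqVneq i i1.
    by rewrite w1 w'1 -S1 addn1 -ejm addnS addSn => -[->].
  have [->{i n1}|n2] := eqVneq i i2.
    by rewrite w2 w'2 S2 addn1 -ejm addnS addSn => ->.
  by rewrite w'3 // => <-; apply/eqP; congr (_ + _)%N; apply: eq_bigr => k' _;
    rewrite M'i.
- apply/forallP=> k'; have /forallP/(_ k')/eqP <- := cM; apply/eqP;
  congr (_ + _)%N.
  have [->{k'}|nk] := eqVneq k' k; last by apply: eq_bigr => i _; rewrite M'k.
  rewrite (bigD1 i1) // (bigD1 i2) 1?eq_sym //= [RHS](bigD1 i1) // [in
    RHS](bigD1 i2) 1?eq_sym //=.
  rewrite M'1 M'2 (eq_bigr (fun i => M (i, k) : nat)) => [|i /andP[n1 n2]];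
    last by rewrite M'i.
  by rewrite addSn addnS -addSn prednK.
- apply/pivotP; split=> //.
  + by rewrite w'V2 M'2.
  + move=> i; have [->{i}|n1] := eqVneq i i1; first
    by rewrite w'1 -ejm ltnNge leqnSn.
    have [->{i n1}|n2] := eqVneq i i2; first by rewrite w'2 ltnn.
    by rewrite w'3 // M'i //; apply: Hj.
  apply/clearedP=> i k' ltk'; rewrite M'k; last
    by rewrite -val_eqE neq_ltn ltk'.
  have [->{i}|n1] := eqVneq i i1; first
    by move=> _; rewrite lowM // w1 (ltn_trans ltk').
  have [->{i n1}|n2] := eqVneq i i2; last by rewrite w'3 //; apply: lowM.
  by move=> _; rewrite lowM // w2 -ltnS ejm (leq_trans _ ltkj) // !ltnS.
rewrite /pivot_step /= -/jm w'V1 w'V2; congr (_, _).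
  by rewrite /w' -mulgA tperm2 mulg1.
apply/ffunP=> q; rewrite ffunE; apply/val_inj.
have [->{q}|n2] := eqVneq q (i2, k); first by rewrite M'2 inord_val.
have [->{q n2}|n1] := eqVneq q (i1, k); last by rewrite M'3.
by rewrite M'1 prednK // inord_val.
Qed.

(** Induction on the column k: the earlier rows and columns being diagonal,
    the only entry of column k is in row i = w^-1 k, and k <= i. It is at most
    the sum la i - i + k of that row, hence at most la k, and it is the column
    sum la k - k + w0 k, hence at least la k. So equality holds everywhere. *)
Lemma no_pivot_diagonal w0 w M : rows_ok w M -> cols_ok w0 M -> cleared w M l ->
  [/\ w0 = 1%g, w = 1%g & M = [ffun q => inord (la q.1 *+ (q.1 == q.2))]].
Proof.
move=> /forallP rM /forallP cM /clearedP lowM.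
have main (k : 'I_l) : [/\ w k = k, w0 k = k &
    forall i, M (i, k) = (la k *+ (i == k))%N :> nat].
  have [m] := ubnP (k : nat); elim: m k => // m IH k; rewrite ltnS => lekm.
  have IHk k' : (k' < k)%N -> [/\ w k' = k', w0 k'
    = k' & forall i, M (i, k') = (la k' *+ (i == k'))%N :> nat].
    by move=> lt; apply: IH; apply: leq_trans lt lekm.
  have fix_ge (u : 'S_l) i : (forall k', (k' < k)%N -> u k' = k') ->
    (k <= i)%N -> (k <= u i)%N.
    move=> fixu lei; rewrite leqNgt; apply/negP=> lt.
    by move: lei; rewrite -(perm_inj (fixu _ lt)) leqNgt lt.
  have w_ge i : (k <= i)%N -> (k <= w i)%N.
    by apply: fix_ge => k' /IHk[].
  have w0k : (k <= w0 k)%N by apply: fix_ge => // k' /IHk[].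
  have rowlt i : (i < k)%N -> M (i, k) = 0 :> nat.
    move=> lt; have [wi _ Mi] := IHk _ lt; have /eqP := rM i.
    rewrite wi (bigD1 i) //= Mi eqxx mulr1n (bigD1 k) /=; last
      by rewrite -val_eqE neq_ltn lt orbT.
    lia.
  set i1 := (w^-1)%g k; have w1 : w i1 = k by rewrite permKV.
  have i1k : (k <= i1)%N.
    rewrite leqNgt; apply/negP=> lt; have [wi _ _] := IHk _ lt.
    by move: lt; rewrite -{1}wi w1 ltnn.
  have M0 i : i != i1 -> M (i, k) = 0 :> nat.
    move=> ni; have [lt|ge] := ltnP i k; first exact: rowlt.
    apply: lowM => //; rewrite ltn_neqAle w_ge // andbT eq_sym val_eqE.
    by apply: contraNneq ni => e; rewrite -(inj_eq (@perm_inj _ w)) w1 e.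
  have colk : (M (i1, k) + k = la k + w0 k)%N.
    have /eqP <- := cM k; rewrite (bigD1 i1) //= big1 ?addn0 // => i ni;
      exact: M0.
  have rowk : (M (i1, k) + i1 <= la i1 + k)%N.
    by have /eqP := rM i1; rewrite w1 => <-;
      rewrite (bigD1 k) //= leq_add2r leq_addr.
  have la1 := la_decr i1k.
  have e1 : i1 = k by apply/val_inj => /=; lia.
  have e0 : w0 k = k by apply/val_inj => /=; lia.
  split=> // [|i]; first by rewrite -{1}e1.
  have [->|ni] := eqVneq i k; last by rewrite M0 ?e1.
  by rewrite mulr1n; move: colk; rewrite e0 e1 => /addIn.
split.
- by apply/permP=> k; rewrite perm1; case: (main k).
- by apply/permP=> k; rewrite perm1; case: (main k).
apply/ffunP=> -[i k]; rewrite ffunE; apply/val_inj => /=;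
  have [_ _ Mk] := main k.
rewrite -[LHS]/(M (i, k) : nat) Mk; have [->|_] := eqVneq i k; last
  by rewrite !mulr0n inordK.
by rewrite !mulr1n inordK // ltnS -la_sum (bigD1 k) //= leq_addr.
Qed.

(** The terms with a pivot cancel in pairs under pivot_step, and the remaining
    one is the diagonal matrix. *)
Lemma jacobi_trudi_count (w0 : 'S_l) :
  \sum_(w : 'S_l) (-1) ^+ w * #|[set M | rows_ok w M && cols_ok w0 M]|%:R
    = (w0 == 1%g)%:R :> algC.
Proof.
pose ok (p : 'S_l * mat) := rows_ok p.1 p.2 && cols_ok w0 p.2.
transitivity (\sum_(p | ok p) (-1) ^+ p.1 : algC).
  rewrite (eq_bigr (fun w : 'S_l => \sum_(M | rows_ok w M && cols_ok w0 M)
    (-1) ^+ w)).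
    by rewrite pair_big_dep.
  by move=> w _; rewrite sumr_const mulr_natr cardsE.
rewrite (bigID (fun p => cleared p.1 p.2 l)) /=.
rewrite [X in _ + X](_ : _ = 0) ?addr0; last first.
  rewrite (eq_bigr (fun p => \sum_(kj : 'I_l * 'I_l | pivot kj.1 kj.2 p.1 p.2)
    (-1) ^+ p.1)).
    rewrite (exchange_big_dep predT) //= big1 // => -[k j] _ /=.
    set P := fun p : 'S_l * mat => ok p && ~~ cleared p.1 p.2 l && pivot k j
      p.1 p.2.
    have stepP p : P p -> P (pivot_step k j p) /\ pivot_step k j (pivot_step k
      j p) = p.
      case/andP=> /andP[/andP[rM cM] _] piv.
      have [rM' cM' piv' ->] := pivot_stepP rM cM piv; split=> //.
      rewrite /P /ok rM' cM' piv' andbT /=; apply/negP=> /clearedP lowM'.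
      have [ltkj M0 _ _] := pivotP _ _ _ _ piv'.
      by rewrite lowM' ?permKV in M0.
    (* The sum equals its opposite, by reindexing along the involution. *)
    apply/eqP; rewrite -eqNr; apply/eqP.
    rewrite [RHS](reindex_onto (pivot_step k j) (pivot_step k j)); last first.
      by move=> p /stepP[].
    rewrite -sumrN; apply: eq_big => [p|p Pp].
      apply/idP/andP=> [/stepP[Pp /eqP] //|[/stepP[+ _] /eqP e]].
      by rewrite e.
    have [ltkj _ _ _] := pivotP _ _ _ _ (andP Pp).2.
    rewrite /= odd_permM odd_tperm signr_addb -val_eqE /=.
    by rewrite neq_ltn ltn_predL (leq_ltn_trans _ ltkj) //= mulrN1.
  move=> p /andP[_ /pivot_exists[k [j piv]]];
    rewrite (bigD1 (k, j)) //= big1 ?addr0 //.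
  move=> [k' j'] /andP[/= piv']; rewrite (pivot_uniq piv' piv).
  by rewrite eqxx.
have [e0|nw0] := eqVneq w0 1%g; last first.
  rewrite big1 // => -[w M] /andP[/andP[rM cM] lowM].
  by have [e _ _] := no_pivot_diagonal rM cM lowM; rewrite e eqxx in nw0.
rewrite /ok e0; pose M0 : mat := [ffun q => inord (la q.1 *+ (q.1 == q.2))].
have M0E i k : M0 (i, k) = (la i *+ (i == k))%N :> nat.
  rewrite ffunE /= inordK // ltnS; case: eqP => // _; rewrite mulr1n.
  by rewrite -la_sum (bigD1 i) //= leq_addr.
have sum1 (F : 'I_l -> nat) (i : 'I_l) : (forall k, k != i -> F k = 0%N) ->
  (\sum_k F k = F i)%N.
  by move=> F0; rewrite (bigD1 i) //= big1 ?addn0.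
rewrite (big_pred1 (1%g, M0)) => [|[w M]]; first by rewrite odd_perm1.
apply/andP/eqP=> [[/andP[/= rM cM] /= lowM]|[-> ->]].
  by have [_ -> ->] := no_pivot_diagonal rM cM lowM.
split; first (apply/andP; split).
- apply/forallP=> i; rewrite perm1 (sum1 _ i) ?M0E ?eqxx // => k nk.
  by rewrite M0E eq_sym (negPf nk).
- apply/forallP=> i; rewrite perm1 (sum1 _ i) ?M0E ?eqxx // => k nk.
  by rewrite M0E (negPf nk).
apply/clearedP=> i k _ /=; rewrite perm1 M0E; case: eqP => // ->;
  by rewrite ltnn.
Qed.

End SignReversing.

(** * Contents of words and Ferrers diagrams *)

Section ContentCharacters.

Variables (n : nat) (T : finType).
Implicit Types (e : pred T) (c : {ffun T -> 'I_n.+1}) (F : {ffun 'I_n -> T}).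

Lemma word_char_is_char e F : word_char e F \is a character.
Proof. exact: indlin_char. Qed.

Lemma eq_content_char e F F' : content F = content F' ->
  word_char e F = word_char e F'.
Proof. by move=> eqc; apply/cfunP=> s; rewrite !word_charE eqc. Qed.

(** Concatenate blocks of equal letters. *)
Lemma content_exists c : (\sum_a c a = n)%N -> exists F, content F = c.
Proof.
move=> sumc; pose s := flatten [seq nseq (c a) a | a <- enum T].
have sz : size s = n.
  rewrite size_flatten /shape -map_comp sumnE big_map big_enum -[RHS]sumc.
  by apply: eq_bigr => a _; rewrite /= size_nseq.
pose t : n.-tuple T := tcast sz (in_tuple s).
exists [ffun i => tnth t i]; apply/ffunP=> a; apply/val_inj;
  rewrite [LHS]contentE.
have -> : #|[set i | [ffun i => tnth t i] i == a]| = count_mem a t.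
  rewrite -[in RHS](map_tnth_enum t) count_map -size_filter cardE enumT
    /enum_mem.
  by congr size; apply: eq_filter => i; rewrite /= inE ffunE.
rewrite val_tcast /= /s count_flatten -map_comp sumnE big_map big_enum /=.
rewrite (bigD1 a) //= count_nseq /= eqxx mul1n big1 ?addn0 // => b nb.
by rewrite count_nseq /= (negPf nb).
Qed.

Lemma content_sum F : (\sum_a content F a = n)%N.
Proof.
rewrite -[RHS]card_ord -sum1_card (partition_big F predT) //=.
by apply: eq_bigr => a _; rewrite contentE -sum1_card; apply: eq_bigl => i;
  rewrite inE.
Qed.

End ContentCharacters.

Section Ferrers.

Variables (l m : nat) (la : 'I_l -> nat).
Hypothesis la_decr : forall i j : 'I_l, (i <= j)%N -> (la j <= la i)%N.
Hypothesis la_bound : forall i, (la i <= m)%N.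

Lemma sum_ltn_ord p : (p <= m)%N -> (\sum_(j < m) (j < p) = p)%N.
Proof.
move=> lepm; transitivity (\sum_(j < m | (j < p)%N) 1)%N.
  by rewrite [RHS]big_mkcond; apply: eq_bigr => j _; case: ltnP.
by rewrite -(big_ord_widen m (fun=> 1%N) lepm) sum1_card card_ord.
Qed.

(** The column of the diagram has its entries on top, so it maximises the
    number of ones in the first k rows for its total. *)
Lemma ferrers_partial (M : 'I_l -> nat) (j k : nat) :
    (forall i, M i <= 1)%N -> (\sum_i M i = \sum_i (j < la i))%N ->
  (\sum_(i : 'I_l | (i < k)%N) M i <= \sum_(i : 'I_l | (i < k)%N) (j < la i))%N.
Proof.
move=> M1 eqM; have [/existsP[i0 /andP[ltik nj]]|] :=
  boolP [exists i : 'I_l, (i < k)%N && ~~ (j < la i)%N].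
  have -> : (\sum_(i : 'I_l | (i < k)%N) (j < la i) = \sum_i (j < la i))%N.
    rewrite [RHS](bigID (fun i : 'I_l =>
      (i < k)%N)) /= [X in (_ + X)%N]big1 ?addn0 // => i.
    rewrite -leqNgt => leki; apply/eqP; rewrite eqb0 -leqNgt.
    by apply: leq_trans (la_decr (ltnW (leq_trans ltik leki))) _;
      rewrite leqNgt.
  by rewrite -eqM [X in (_ <= X)%N](bigID (fun i : 'I_l => (i < k)%N)) leq_addr.
rewrite negb_exists => /forallP allF; apply: leq_sum => i ltik.
by have := allF i; rewrite ltik negbK => ->.
Qed.

(** Summing ferrers_partial over the columns bounds the sum of the first k row
    sums, hence that of the values of w on the first k indices; so w is the
    identity, all these bounds are equalities, and M is the diagram. *)
Lemma ferrers_rigidity (M : 'I_l -> 'I_m -> nat) (w : 'S_l) :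
    (forall i j, M i j <= 1)%N ->
    (forall j, \sum_i M i j = \sum_i (j < la i))%N ->
    (forall i, \sum_j M i j + i = la i + w i)%N ->
  w = 1%g /\ forall i j, M i j = (j < la i)%N.
Proof.
move=> M1 cM rM; have partM k j := ferrers_partial k (M1^~ j) (cM j).
have sumF k : (\sum_(j < m) \sum_(i : 'I_l | i < k) (j < la i)
  = \sum_(i : 'I_l | i < k) la i)%N.
  by rewrite exchange_big; apply: eq_bigr => i _; rewrite sum_ltn_ord.
have sumM k : (\sum_(j < m) \sum_(i : 'I_l | i < k) M i j + \sum_(i : 'I_l | i
  < k) i
     = \sum_(i : 'I_l | i < k) la i + \sum_(i : 'I_l | i < k) w i)%N.
  by rewrite exchange_big -!big_split /=; apply: eq_bigr.
have leM k : (\sum_(j < m) \sum_(i : 'I_l | i < k) M i j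
  <= \sum_(i : 'I_l | i < k) la i)%N.
  by rewrite -sumF leq_sum.
have split_last (f : 'I_l -> nat) (k : 'I_l) :
    (\sum_(i : 'I_l | i < k.+1) f i = f k + \sum_(i : 'I_l | i < k) f i)%N.
  rewrite (bigD1 k) //=; congr (_ + _)%N; apply: eq_bigl => i.
  by rewrite ltnS andbC -val_eqE -ltn_neqAle.
have w1 (k : 'I_l) : w k = k.
  have [p] := ubnP (k : nat); elim: p k => // p IH k; rewrite ltnS => lekp.
  have IHk (i : 'I_l) : (i < k)%N -> w i = i
    by move=> lt; apply: IH; apply: leq_trans lt lekp.
  apply/val_inj/eqP; rewrite eqn_leq; apply/andP; split; last first.
    rewrite leqNgt; apply/negP=> lt; have := IHk _ lt; move/perm_inj => e.
    by rewrite e ltnn in lt.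
  have := leM k.+1; have := sumM k.+1.
  have eqw : (\sum_(i : 'I_l | i < k) w i = \sum_(i : 'I_l | i < k) i)%N.
    by apply: eq_bigr => i /IHk->.
  rewrite (split_last (fun i => w i)) (split_last (@nat_of_ord l)) eqw /=; lia.
have ew : w = 1%g by apply/permP=> k; rewrite perm1 w1.
split=> // i0 j0.
have eqMF k j : (\sum_(i : 'I_l | i < k) M i j
  = \sum_(i : 'I_l | i < k) (j < la i))%N.
  pose A j := (\sum_(i : 'I_l | i < k) M i j)%N.
  pose B j := (\sum_(i : 'I_l | i < k) (j < la i))%N.
  have [_ eqAB] := @leqif_sum _ predT (fun j : 'I_m =>
    A j == B j) A B (fun j _ => (partM k j, erefl)).
  have : (\sum_(j : 'I_m) A j == \sum_(j : 'I_m) B j)%N.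
    rewrite [X in _ == X]sumF -(eqn_add2r (\sum_(i : 'I_l | i < k) i)%N) sumM.
    by apply/eqP; congr (_ + _)%N; apply: eq_bigr => i _; rewrite w1.
  by rewrite eqAB => /forall_inP/(_ j isT)/eqP.
by have := eqMF i0.+1 j0; rewrite !split_last eqMF => /addIn->.
Qed.

End Ferrers.

(** * Specht characters as common constituents *)

Section Tableau.

Variables (n : nat) (la : seq nat).
Hypothesis la_part : is_partition n la.

Local Notation l := (size la).
Definition part (i : 'I_l) : nat := nth 0%N la i.

Lemma part_sumn : sumn la = n.
Proof. by case/and3P: la_part => _ _ /eqP. Qed.

Lemma part_gt0 i : (0 < part i)%N.
Proof.
case/and3P: la_part => _ la0 _; rewrite lt0n; apply: contraNneq la0 => <-.
exact: mem_nth.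
Qed.

Lemma part_decr (i j : 'I_l) : (i <= j)%N -> (part j <= part i)%N.
Proof.
case/and3P: la_part => srt _ _ leij.
apply: (sorted_leq_nth (leT := geq)) => //; rewrite ?inE //.
  by move=> x y z /= xy yz; apply: leq_trans yz xy.
exact: leqnn.
Qed.

Lemma part_sum : (\sum_i part i = n)%N.
Proof. by rewrite -part_sumn sumnE (big_nth 0%N) big_mkord. Qed.

Lemma part_bound i : (part i <= n)%N.
Proof. by rewrite -part_sum (bigD1 i) //= leq_addr. Qed.

Lemma row_of_proof (x : 'I_n) : (reshape_index la x < l)%N.
Proof. by apply: reshape_indexP; rewrite part_sumn. Qed.

Lemma col_of_proof (x : 'I_n) : (reshape_offset la x < n)%N.
Proof. exact: leq_ltn_trans (leq_subr _ _) (ltn_ord x). Qed.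

Definition row_word : {ffun 'I_n -> 'I_l} :=
  [ffun x => Ordinal (row_of_proof x)].
Definition col_word : {ffun 'I_n -> 'I_n} :=
  [ffun x => Ordinal (col_of_proof x)].

Lemma row_stabE : row_stab n la = word_stab row_word.
Proof.
apply/setP=> s; rewrite !inE; apply: eq_forallb => x.
by rewrite !ffunE -val_eqE.
Qed.

Lemma col_stabE : col_stab n la = word_stab col_word.
Proof.
apply/setP=> s; rewrite !inE; apply: eq_forallb => x.
by rewrite !ffunE -val_eqE.
Qed.

Lemma row_col_inj (x y : 'I_n) : row_word x = row_word y ->
  col_word x = col_word y -> x = y.
Proof.
rewrite !ffunE => /(congr1 val) /= er /(congr1 val) /= ec.
by apply/val_inj => /=; rewrite -(reshape_indexK la x) -(reshape_indexK la y)
  er ec.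
Qed.

Lemma tableau_content (i : 'I_l) (j : 'I_n) :
  content (word_pair row_word col_word) (i, j) = (j < part i)%N :> nat.
Proof.
rewrite contentE; case: ltnP => [ltj|gej].
  have lx := flatten_indexP ltj; rewrite part_sumn in lx.
  rewrite (_ : [set _ | _] = [set Ordinal lx]) ?cards1 //.
  apply/setP=> x; rewrite !inE !ffunE -val_eqE xpair_eqE -!val_eqE /=.
  apply/andP/eqP=> [[/eqP <- /eqP <-]|->]; first by rewrite reshape_indexK.
  by rewrite flatten_indexKl // flatten_indexKr.
apply: eq_card0 => x; rewrite !inE !ffunE xpair_eqE -!val_eqE /=.
apply/negP=> /andP[/eqP ei /eqP ej].
have := @reshape_offsetP la x; rewrite part_sumn => /(_ (ltn_ord x)).
by rewrite ei ej ltnNge gej.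
Qed.

Lemma row_content i : content row_word i = part i :> nat.
Proof.
have := content_fst (word_pair row_word col_word) i;
  rewrite word_fst_pair => ->.
by rewrite (eq_bigr _ (fun j _ => tableau_content i j)) sum_ltn_ord ?part_bound.
Qed.

Lemma col_content j : content col_word j = (\sum_i (j < part i))%N :> nat.
Proof.
have := content_snd (word_pair row_word col_word) j;
  rewrite word_snd_pair => ->.
by apply: eq_bigr => i _; apply: tableau_content.
Qed.

(** Only the diagram itself is a 0-1 matrix with these sums, by
    ferrers_rigidity. *)
Lemma row_col_joint (w : 'S_l) (F : {ffun 'I_n -> 'I_l}) :
    (forall i, content F i + i = part i + w i)%N ->
  #|joint_contents pred0 predT F col_word| = (w == 1%g).
Proof.
move=> Fw.
have jointE c : c \in joint_contents pred0 predT F col_word ->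
    w = 1%g /\ forall i j, c (i, j) = (j < part i)%N :> nat.
  rewrite inE => /andP[/existsP[Z /and3P[/eqP <- /eqP ZF /eqP ZC]] /forallP
    le1].
  apply: (ferrers_rigidity part_decr part_bound).
  - by move=> i j; have := le1 (i, j); rewrite /mixed /=.
  - by move=> j; rewrite -content_snd ZC col_content.
  by move=> i; rewrite -content_fst ZF Fw.
have [w1|nw] := eqVneq w 1%g; last first.
  by apply: eq_card0 => c; apply/negP=> /jointE[e _]; rewrite e eqxx in nw.
pose c0 := content (word_pair row_word col_word).
apply/eqP/cards1P; exists c0; apply/setP=> c; rewrite [RHS]inE; apply/idP/eqP.
  by case/jointE=> _ cE; apply/ffunP=> -[i j]; apply/val_inj;
    rewrite /= cE tableau_content.
move=> ->; rewrite inE; apply/andP; split.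
  apply/existsP; exists (word_pair row_word col_word).
  rewrite word_fst_pair word_snd_pair !eqxx andbT /=; apply/eqP/ffunP=> i;
    apply/val_inj => /=.
  by apply/eqP; rewrite -(eqn_add2r i) Fw w1 perm1 row_content.
by apply/forallP=> -[i j]; rewrite /c0 tableau_content leq_b1 implybT.
Qed.

Lemma row_col_cfdot : '[word_char pred0 row_word, word_char predT col_word] = 1.
Proof.
rewrite word_char_cfdot (row_col_joint (w := 1%g)) ?eqxx // => i.
by rewrite row_content perm1.
Qed.

Lemma word_parity0 (T : finType) (F : {ffun 'I_n -> T}) s :
  word_parity pred0 F s = false.
Proof.
rewrite /word_parity (_ : restr_perm _ _ = 1%g) ?odd_perm1 //.
by apply/permP=> x; rewrite (out_perm (restr_perm_on _ _)) ?perm1 // inE.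
Qed.

Lemma word_parityT (T : finType) (F : {ffun 'I_n -> T}) s :
  word_parity predT F s = s.
Proof.
rewrite /word_parity (_ : restr_perm _ _ = s) //; apply/permP=> x.
have nB : s \in ('N(marked predT F | 'P))%g
  by apply/stab_setP=> y; rewrite !inE.
by rewrite restr_permE // inE.
Qed.

(** The right ideal of the Young symmetrizer affords a common constituent of
    the two induced characters, and row_col_cfdot leaves room for one only. *)
Lemma specht_char_spec :
  specht_char n la \in irr [set: 'S_n] /\
  (forall i, '[word_char pred0 row_word, 'chi_i] != 0 ->
     '[word_char predT col_word, 'chi_i] != 0 -> 'chi_i = specht_char n la).
Proof.
have tiRC : word_stab row_word :&: word_stab col_word = 1%g.
  apply/trivgP/subsetP=> s; rewrite inE => /andP[/word_stabP Rs /word_stabP Cs].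
  by apply/set1P/permP=> x; rewrite perm1; apply: row_col_inj.
have dot1 := row_col_cfdot.
have dotE : word_char pred0 row_word = indlin (word_stab row_word) xpred0.
  apply/cfunP=> s; rewrite !indlinE //; last exact: word_parityM.
  by congr (_ * _); apply: eq_bigr => y _; rewrite word_parity0.
have bRC : word_char predT col_word = indlin (word_stab col_word) (@odd_perm _).
  apply/cfunP=> s; rewrite indlinE; last exact: word_parityM.
  rewrite indlinE; last by move=> x y _ _; exact: odd_permM.
  by congr (_ * _); apply: eq_bigr => y _; rewrite word_parityT.
have bM : {in word_stab col_word &, forall s t, odd_perm (s * t)%g
  = odd_perm s (+) odd_perm t}.
  by move=> s t _ _; exact: odd_permM.
rewrite dotE bRC in dot1 *.
have E : young_symmetrizer n la
    = symmetrizer (word_stab row_word) (word_stab col_word) (@odd_perm _).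
  by rewrite -row_stabE -col_stabE.
by have := symmetrizer_char bM tiRC dot1; rewrite /specht_char E.
Qed.

End Tableau.

(** * The Jacobi-Trudi formula for Specht characters *)

Section JacobiTrudi.

Variables (n : nat) (la : seq nat).
Hypothesis la_part : is_partition n la.

Local Notation l := (size la).
Local Notation part := (@part la).
Implicit Types (w : 'S_l) (F : {ffun 'I_n -> 'I_l}).

(** The condition rows_ok, for the content of a word. *)
Definition jt_word w F := [forall i, (content F i + i == part i + w i)%N].

(** The product of complete homogeneous functions in the term of w of the
    determinant: the permutation character on the words with jt_word w, or 0
    if there are none. *)
Definition jt_char w : 'CF([set: 'S_n]) :=
  if [pick F | jt_word w F] is Some F then word_char pred0 F else 0.

Lemma jt_word_content w F F' : jt_word w F ->
  (content F' == content F) = jt_word w F'.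
Proof.
move=> /forallP jF; apply/eqP/forallP=> [-> //|jF'].
apply/ffunP=> i; apply/val_inj/eqP => /=.
by rewrite -(eqn_add2r i) (eqP (jF i)) (eqP (jF' i)).
Qed.

Lemma jt_charE w s :
  jt_char w s = #|[set F | jt_word w F && (s \in word_stab F)]|%:R.
Proof.
rewrite /jt_char; case: pickP => [F jF|nF]; last first.
  by rewrite cfunE (_ : [set _ | _] = set0) ?cards0 //; apply/setP=> F;
    rewrite !inE nF.
rewrite word_charE -sum1_card natr_sum big_mkcond [RHS]big_mkcond /=.
apply: eq_bigr => F' _; rewrite (jt_word_content _ jF) inE /word_sign
  word_parity0 expr0.
by case: (jt_word _ _); case: (_ \in _).
Qed.

Lemma jt_char_vchar w : jt_char w \in ('Z[irr [set: 'S_n]])%g.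
Proof.
rewrite /jt_char; case: pickP => [F _|_]; last exact: rpred0.
by rewrite char_vchar ?word_char_is_char.
Qed.

Lemma rows_ok_word w (M : {ffun 'I_l * 'I_l -> 'I_n.+1}) : rows_ok part w M ->
  exists2 Z : {ffun 'I_n -> 'I_l * 'I_l}, content Z
    = M & jt_word w (word_fst Z).
Proof.
move=> rM; have [|Z ZM] := @content_exists n _ M.
  by rewrite -[RHS](mat_sum (part_sum la_part) rM) pair_bigA;
    apply: eq_bigr => -[].
exists Z => //; apply/forallP=> i; rewrite content_fst ZM.
by have /forallP := rM; apply.
Qed.

Lemma cols_ok_word w (Z : {ffun 'I_n -> 'I_l * 'I_l}) :
  cols_ok part w (content Z) = jt_word w (word_snd Z).
Proof. by apply: eq_forallb => i; rewrite content_snd. Qed.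

Lemma rows_ok_fst w (Z : {ffun 'I_n -> 'I_l * 'I_l}) :
  rows_ok part w (content Z) = jt_word w (word_fst Z).
Proof. by apply: eq_forallb => i; rewrite content_fst. Qed.

Lemma jt_char_cfdot w w0 :
  '[jt_char w, jt_char w0] =
    #|[set M : {ffun 'I_l * 'I_l -> 'I_n.+1} | rows_ok part w M && cols_ok
      part w0 M]|%:R.
Proof.
rewrite /jt_char; case: pickP => [F jF|nF]; last first.
  rewrite cfdot0l (_ : [set _ | _] = set0) ?cards0 //; apply/setP=> M;
    rewrite !inE.
  by apply/negP=> /andP[/rows_ok_word[Z _]]; rewrite nF.
case: pickP => [F0 jF0|nF0]; last first.
  rewrite cfdot0r (_ : [set _ | _] = set0) ?cards0 //; apply/setP=> M;
    rewrite !inE.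
  by apply/negP=> /andP[/rows_ok_word[Z <- _]]; rewrite cols_ok_word nF0.
rewrite word_char_cfdot; congr _%:R; apply: eq_card => M; rewrite !inE.
apply/andP/andP=> [[/existsP[Z /and3P[/eqP <- ZF ZF0]] _]|[rM cM]].
  by rewrite rows_ok_fst cols_ok_word -(jt_word_content _ jF)
    -(jt_word_content _ jF0).
split; last by apply/forallP=> p; rewrite /mixed.
have [Z ZM jZ] := rows_ok_word rM; apply/existsP; exists Z.
rewrite ZM eqxx (jt_word_content _ jF) jZ (jt_word_content _ jF0) /=.
by rewrite -cols_ok_word ZM.
Qed.

(** The determinant of the complete homogeneous functions of index part i - i
    + j, where products stand for induction from Young subgroups. *)
Definition jt_det : 'CF([set: 'S_n]) := \sum_(w : 'S_l) (-1) ^+ w *: jt_char w.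

Lemma jt_det_cfdot w0 : '[jt_det, jt_char w0] = (w0 == 1%g)%:R.
Proof.
rewrite /jt_det cfdot_suml -(jacobi_trudi_count (part_decr la_part) (part_sum
  la_part)).
by apply: eq_bigr => w _; rewrite cfdotZl jt_char_cfdot.
Qed.

Lemma jt_char1 : jt_char 1%g = word_char pred0 (row_word la_part).
Proof.
have jR : jt_word 1%g (row_word la_part).
  by apply/forallP=> i; rewrite row_content perm1.
rewrite /jt_char; case: pickP => [F jF|/(_ (row_word la_part))]; last
  by rewrite jR.
by apply: eq_content_char; apply/eqP; rewrite (jt_word_content _ jR).
Qed.

Lemma jt_char_col w :
  '[jt_char w, word_char predT (col_word n la)] = (w == 1%g)%:R.
Proof.
rewrite /jt_char; case: pickP => [F /forallP jF|nF].
  by rewrite word_char_cfdot (row_col_joint la_part (w := w)) // => i;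
    apply/eqP.
rewrite cfdot0l; case: eqP => // w1; have := nF (row_word la_part).
by rewrite (_ : jt_word _ _) //; apply/forallP=> i;
  rewrite w1 row_content perm1.
Qed.

(** The determinant is a generalized character of norm 1, hence an irreducible
    character up to sign. Its scalar products with the two induced characters
    that define the Specht character are both 1, since the other terms of the
    determinant have contents that dominate the shape. So it is the Specht
    character, with sign +. *)
Lemma specht_jacobi_trudi : specht_char n la = jt_det.
Proof.
have vD : jt_det \in ('Z[irr [set: 'S_n]])%g.
  rewrite /jt_det rpred_sum // => w _; rewrite rpredZsign.
  exact: jt_char_vchar.
have normD : '[jt_det] = 1.
  rewrite {2}/jt_det cfdot_sumr (bigD1 1%g) //= big1 => [|w nw].
    by rewrite odd_perm1 scale1r jt_det_cfdot eqxx addr0.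
  by rewrite cfdotZr jt_det_cfdot (negPf nw) mulr0.
have dotC : '[jt_det, word_char predT (col_word n la)] = 1.
  rewrite /jt_det cfdot_suml (bigD1 1%g) //= big1 => [|w nw].
    by rewrite odd_perm1 scale1r jt_char_col eqxx addr0.
  by rewrite cfdotZl jt_char_col (negPf nw) mulr0.
have dotR := jt_det_cfdot 1%g; rewrite jt_char1 eqxx in dotR.
have [b [i Di]] := vchar_norm1P vD normD.
have nz1 := oner_neq0 algC.
have dR : '[word_char pred0 (row_word la_part), jt_det] = 1
  by rewrite cfdotC dotR conjC1.
have dC : '[word_char predT (col_word n la), jt_det] = 1
  by rewrite cfdotC dotC conjC1.
have e : 'chi_i = specht_char n la.
  have [_ uniq] := specht_char_spec la_part; apply: uniq.
    by apply: contra_eqN dR => /eqP e0; rewrite Di cfdotZr e0 mulr0 eq_sym.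
  by apply: contra_eqN dC => /eqP e0; rewrite Di cfdotZr e0 mulr0 eq_sym.
case: b Di => [Di|->]; last by rewrite scale1r e.
have : 0 <= '[word_char pred0 (row_word la_part), 'chi_i].
  by rewrite natr_ge0 // Cnat_cfdot_char_irr // word_char_is_char.
have -> : 'chi_i = - jt_det by rewrite Di expr1 scaleN1r opprK.
by rewrite cfdotNr dR oppr_ge0 ler10.
Qed.

End JacobiTrudi.

(** * Values of Specht characters at squares and at two equal cycles *)

Section StableWords.

Variables (n : nat) (T : finType) (F : {ffun 'I_n -> T}).
Implicit Types (s t : 'S_n).

Lemma word_stabX s k x : s \in word_stab F -> F ((s ^+ k)%g x) = F x.
Proof.
move=> Fs; have /word_stabP -> // : (s ^+ k)%g \in word_stab F.
exact: (@groupX _ (word_stab_group F)).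
Qed.

(** On an odd cycle of length c, s is the power of exponent (c + 1) / 2 of its
    square. *)
Lemma word_stab_sqr_odd s :
    (forall X, X \in porbits s -> odd #|X|) ->
  (s \in word_stab F) = ((s ^+ 2)%g \in word_stab F).
Proof.
move=> odds; apply/idP/idP=> [Fs|Fs2];
  first exact: (@groupX _ (word_stab_group F)).
apply/word_stabP=> x; have oddx := odds _ (imset_f (porbit s) (isT : x \in
  'I_n)).
have <- : ((s ^+ 2) ^+ (uphalf #|porbit s x|))%g x = s x;
  last exact: word_stabX.
by rewrite -expgM mul2n odd_uphalfK // permX iterS iter_porbit.
Qed.

End StableWords.

Lemma hook_of_ones n (la : seq nat) : (0 < n)%N -> is_partition n la ->
  (forall i : 'I_(size la), (0 < i)%N -> part i = 1%N) -> is_hook n la.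
Proof.
move=> n_gt0 la_part ones; have := part_sumn la_part;
  have := @part_gt0 n la la_part.
case: la la_part ones => [|a r] /= la_part ones gt0 sum_la; first
  by rewrite -sum_la in n_gt0.
have a0 : (0 < a)%N := gt0 ord0.
have Dr : r = nseq (size r) 1%N.
  apply/all_pred1P/(all_nthP 0%N) => i lti /=.
  by apply/eqP; apply: (ones (@Ordinal (size r).+1 i.+1 lti)).
have sr : sumn r = size r by rewrite Dr sumn_nseq size_nseq mul1n.
exists (size r); first by rewrite -sum_la sr -{1}[size r]add0n ltn_add2r.
by rewrite /hook -sum_la sr addnK -Dr.
Qed.

Section TwoOrbits.

Variables (n : nat) (la : seq nat) (m : nat).
Hypothesis la_part : is_partition n la.

Local Notation l := (size la).
Local Notation part := (@part la).
Implicit Types (w : 'S_l) (i a b : 'I_l) (p : 'I_l * 'I_l).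

(** The word with letter p.1 on one orbit of size m and p.2 on the other
    satisfies jt_word w. *)
Definition rim w p :=
  [forall i, (m * (p.1 == i) + m * (p.2 == i) + i == part i + w i)%N].

Definition rim_sign p : algC := \sum_(w | rim w p) (-1) ^+ w.

(** The value of the determinant at a permutation with two cycles of length m,
    whose fixed words are the pairs of letters p. *)
Definition two_orbit_value : algC := \sum_p rim_sign p.

Lemma specht_two_orbits (s : 'S_n) (O1 O2 : {set 'I_n}) :
    porbits s = [set O1; O2] -> O1 != O2 -> #|O1| = m -> #|O2| = m ->
  specht_char n la s = two_orbit_value.
Proof.
move=> sO neqO card1 card2.
have [x1 Ox1] : exists x, x \in O1.
  have : O1 \in porbits s by rewrite sO !inE eqxx.
  by case/imsetP=> x _ ->; exists x; apply: porbit_id.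
have [x2 Ox2] : exists x, x \in O2.
  have : O2 \in porbits s by rewrite sO !inE eqxx orbT.
  by case/imsetP=> x _ ->; exists x; apply: porbit_id.
have orb x : porbit s x = if x \in O1 then O1 else O2.
  have /imsetP : O1 \in porbits s by rewrite sO !inE eqxx.
  case=> y _ Dy; case: ifP => [|nO].
    by rewrite Dy -eq_porbit_mem => /eqP.
  have : porbit s x \in porbits s by apply: imset_f.
  rewrite sO !inE => /orP[]/eqP // e.
  by rewrite -e porbit_id in nO.
have O2E x : (x \in O2) = (x \notin O1).
  have [xO|xO] := boolP (x \in O1).
    apply/negP=> xO2; have /imsetP[y _ Dy] : O2 \in porbits s
      by rewrite sO !inE eqxx orbT.
    have := orb x; rewrite xO => e; case/eqP: neqO.
    by rewrite -e Dy; apply/eqP; rewrite eq_porbit_mem -Dy.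
  by have := porbit_id s x; rewrite orb (negPf xO).
pose Fp p : {ffun 'I_n -> 'I_l} := [ffun x => if x \in O1 then p.1 else p.2].
have Fp_stab p : s \in word_stab (Fp p).
  apply/word_stabP=> x; rewrite !ffunE.
  have : porbit s (s x) = porbit s x
    by have := porbit_perm s 1 x; rewrite expg1.
  rewrite !orb; case: (x \in O1); case: (s x \in O1) => // e;
    by move: neqO; rewrite e eqxx.
have Fp_content p i : content (Fp p) i
  = (m * (p.1 == i) + m * (p.2 == i))%N :> nat.
  rewrite contentE -sum1_card (bigID (mem O1)) /=; congr (_ + _)%N.
    case: (p.1 =P i) => [e|ne]; rewrite ?muln1 ?muln0.
      rewrite -card1 -sum1_card; apply: eq_bigl => x; rewrite inE ffunE.
      by case: (x \in O1); rewrite ?andbF // e eqxx.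
    by rewrite big1 // => x; rewrite inE ffunE => /andP[+ xO];
      rewrite xO => /eqP.
  case: (p.2 =P i) => [e|ne]; rewrite ?muln1 ?muln0.
    rewrite -card2 -sum1_card; apply: eq_bigl => x; rewrite inE ffunE O2E.
    by case: (x \in O1); rewrite ?andbF // e eqxx.
  by rewrite big1 // => x; rewrite inE ffunE => /andP[+ /negPf xO];
    rewrite xO => /eqP.
rewrite (specht_jacobi_trudi la_part) /jt_det sum_cfunE /two_orbit_value.
rewrite /rim_sign (exchange_big_dep predT) //=; apply: eq_bigr => w _.
rewrite cfunE jt_charE // -sum1_card natr_sum mulr_sumr.
rewrite (eq_bigl (fun F => (s \in word_stab F) && jt_word w F)); last first.
  by move=> F; rewrite inE andbC.
rewrite (reindex Fp) /=; last first.
  exists (fun F : {ffun 'I_n -> 'I_l} => (F x1, F x2)) =>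
    [[a b] _|F /andP[Fs _]].
    by rewrite !ffunE /= Ox1 -[x2 \in O1]negbK -O2E Ox2.
  apply/ffunP=> x; rewrite ffunE /=; case: ifP => xO.
    have : x \in porbit s x1 by rewrite orb Ox1.
    by case/porbitP=> i ->; rewrite word_stabX.
  have : x \in porbit s x2 by rewrite orb -[x2 \in O1]negbK -O2E Ox2 O2E xO.
  by case/porbitP=> i ->; rewrite word_stabX.
apply: eq_big => [p|p _]; last by rewrite mulr1.
by rewrite Fp_stab /=; apply: eq_forallb => i; rewrite Fp_content.
Qed.

Hypothesis n_gt0 : (0 < n)%N.
Hypothesis m_gt0 : (0 < m)%N.
Hypothesis la_nhook : ~ is_hook n la.

Lemma rim_at w p i : rim w p -> (m * (p.1 == i) + m * (p.2 == i) + i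
  = part i + w i)%N.
Proof. by move/forallP/(_ i)/eqP. Qed.

(** A single letter a must be the first one, as the condition at index 0
    shows. Then w i < i for all other i, which forces w i = i - 1, so all
    other parts are 1. *)
Lemma rim_diag w a : rim w (a, a) -> False.
Proof.
move=> rw; apply: la_nhook; apply: (hook_of_ones n_gt0 la_part) => i.
have l_gt0 : (0 < l)%N := leq_ltn_trans (leq0n a) (ltn_ord a).
have a0 : a = 0%N :> nat.
  apply/eqP/negPn/negP=> na; have := rim_at (Ordinal l_gt0) rw.
  rewrite -!val_eqE /= (negPf na) !muln0 /= => /eqP.
  by rewrite eq_sym addn_eq0 eqn0Ngt (part_gt0 la_part).
have wi (j : 'I_l) : (0 < j)%N -> (part j + w j = j)%N.
  by move=> j0; rewrite -(rim_at _ rw) /= -val_eqE /= a0 (ltn_eqF j0) !muln0.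
have [k] := ubnP (i : nat); elim: k i => // k IH i; rewrite ltnS => leik i0.
have := wi i i0; case: (ltngtP (part i) 1) => // [|lt1 ei].
  by rewrite ltnS leqNgt (part_gt0 la_part).
(* Otherwise w i = w j for the smaller index j = w i + 1. *)
have ltw : ((w i).+1 < i)%N by rewrite -[X in (_ < X)%N]ei -[(w i).+1]add1n
  ltn_add2r.
have ltl : ((w i).+1 < l)%N := ltn_trans ltw (ltn_ord i).
pose j : 'I_l := Ordinal ltl.
have := IH j; rewrite (leq_trans ltw leik) => /(_ isT isT) pj.
have := wi j isT; rewrite pj add1n => -[] /val_inj/perm_inj ej.
by have := ltw; rewrite -[X in (_ < nat_of_ord X)%N]ej /= ltnn.
Qed.

(** At index 0, the condition would otherwise make the first part nonpositive.
    *)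
Lemma rim_zero w a b : rim w (a, b) -> (a = 0%N :> nat) \/ (b = 0%N :> nat).
Proof.
move=> rw; have l_gt0 : (0 < l)%N := leq_ltn_trans (leq0n a) (ltn_ord a).
have := rim_at (Ordinal l_gt0) rw; rewrite -!val_eqE /=.
case: (nat_of_ord a =P 0%N) => [|_]; first by left.
case: (nat_of_ord b =P 0%N) => [|_]; first by right.
by rewrite !muln0 => /eqP; rewrite eq_sym addn_eq0 eqn0Ngt (part_gt0 la_part).
Qed.

Lemma rim_sym w a b : rim w (a, b) = rim w (b, a).
Proof. by apply: eq_forallb => i; rewrite /= [(m * _ + m * _)%N]addnC. Qed.

Lemma rim_neq w a b : rim w (a, b) -> a != b.
Proof. by move=> rw; apply/eqP=> e; rewrite e in rw; apply: rim_diag rw. Qed.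

(** If b < b', the value b - part b of w' at b is taken by w at b' only, so
    that it equals b' - part b'; but i - part i increases strictly with i. *)
Lemma rim_second (w w' : 'S_l) (a b b' : 'I_l) :
  a = 0%N :> nat -> rim w (a, b) -> rim w' (a, b') -> b = b'.
Proof.
move=> a0; wlog ltb : b b' w w' / (b < b')%N.
  move=> IH rw rw'; have [lt|lt|/val_inj //] := ltngtP b b';
    first exact: IH rw rw'.
  by symmetry; apply: IH rw' rw.
move=> rw rw'; have nab := rim_neq rw; have nab' := rim_neq rw'.
have wb' : (b' = part b' + w b' :> nat)%N.
  rewrite -(rim_at _ rw) /= -!val_eqE /= a0 !(ltn_eqF (leq_ltn_trans _ ltb)) //.
  by rewrite !muln0.
have w'b : (b = part b + w' b :> nat)%N.
  rewrite -(rim_at _ rw') /= (negPf nab) [b' == b]eq_sym -[b == b']val_eqE.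
  by rewrite (ltn_eqF ltb) !muln0.
have wb : (m + b = part b + w b)%N.
  by rewrite -(rim_at _ rw) /= (negPf nab) eqxx muln0 muln1.
(* The permutations w and w' agree outside b and b', so w takes the value of
   w' at b nowhere but at b'. *)
pose i := (w^-1)%g (w' b); have wi : w i = w' b by rewrite permKV.
have nib : i != b.
  apply/eqP=> ei; move: wb; rewrite -ei wi ei => /eqP.
  by rewrite -w'b -[X in _ == X]add0n eqn_add2r => /eqP m0; move: m_gt0;
    rewrite m0.
have eib' : i = b'.
  apply/eqP/negPn/negP=> nib'; have := rim_at i rw; have := rim_at i rw'.
  rewrite /= ![_ == i]eq_sym (negPf nib) (negPf nib') => -> /addnI /val_inj.
  by rewrite wi => /perm_inj ei; rewrite ei eqxx in nib.
rewrite -eib' wi in wb'; have := part_decr la_part (ltnW ltb).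
move: ltb; rewrite -eib'; lia.
Qed.

Lemma rim_pair (w w' : 'S_l) p p' :
  rim w p -> rim w' p' -> p' = p \/ p' = (p.2, p.1).
Proof.
case: p p' => [a b] [a' b'] /= rw rw'.
have ord0_uniq (x y : 'I_l) : x = 0%N :> nat -> y = 0%N :> nat -> x = y.
  by move=> x0 y0; apply/val_inj; rewrite /= x0 y0.
have [a0|b0] := rim_zero rw; have [a'0|b'0] := rim_zero rw'.
- have e := ord0_uniq _ _ a'0 a0; rewrite e in rw' *.
  by rewrite (rim_second a0 rw rw'); left.
- have e := ord0_uniq _ _ b'0 a0; rewrite rim_sym e in rw' *.
  by rewrite (rim_second a0 rw rw'); right.
- have e := ord0_uniq _ _ a'0 b0; rewrite rim_sym in rw; rewrite e in rw' *.
  by rewrite (rim_second b0 rw rw'); right.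
have e := ord0_uniq _ _ b'0 b0; rewrite rim_sym in rw;
  rewrite rim_sym e in rw' *.
by rewrite (rim_second b0 rw rw'); left.
Qed.

Lemma rim_sign_sym a b : rim_sign (a, b) = rim_sign (b, a).
Proof. by apply: eq_bigl => w; rewrite rim_sym. Qed.

(** By rim_pair, at most one unordered pair of distinct letters contributes;
    it does so in both orders, with the sign of a unique permutation. *)
Lemma two_orbit_value_bound : two_orbit_value \in [:: -2; 0; 2].
Proof.
have [/existsP[w /existsP[[a b] rw]]|none] :=
  boolP [exists w, [exists p, rim w p]]; last first.
  rewrite /two_orbit_value big1 ?inE ?eqxx ?orbT // => p _.
  rewrite /rim_sign big1 // => w rw; case/negP: none.
  by apply/existsP; exists w; apply/existsP; exists p.
have nab := rim_neq rw.
have sign_ab : rim_sign (a, b) = (-1) ^+ w.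
  rewrite /rim_sign (big_pred1 w) // => w'; apply/idP/eqP=> [rw'|-> //].
  apply/permP=> i; apply/val_inj/(@addnI (part i)) => /=.
  by rewrite -(rim_at _ rw) -(rim_at _ rw').
have -> : two_orbit_value = (-1) ^+ w *+ 2.
  rewrite /two_orbit_value (bigD1 (a, b)) //= (bigD1 (b, a)) /=; last first.
    by rewrite xpair_eqE negb_and eq_sym nab.
  rewrite (rim_sign_sym b a) sign_ab big1 ?addr0 // => p /andP[n1 n2].
  rewrite /rim_sign big1 // => w' rw'; case: (rim_pair rw rw') => /= e.
    by rewrite e eqxx in n1.
  by rewrite e eqxx in n2.
by rewrite -mulr_natr !inE; case: (odd_perm w);
  rewrite ?expr1 ?expr0 ?mulN1r ?mul1r ?eqxx ?orbT.
Qed.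

End TwoOrbits.

(** * Separating hook characters from the other Specht characters *)

Section Constituents.

Variables (gT : finGroupType) (G : {group gT}).
Implicit Types phi psi : 'CF(G).

Lemma common_constituent phi psi :
  '[phi, psi] != 0 -> exists i, '[phi, 'chi_i] != 0 /\ '[psi, 'chi_i] != 0.
Proof.
rewrite cfdot_sum_irr => nz.
case: (pickP (fun i => ('[phi, 'chi_i] != 0) && ('[psi, 'chi_i] != 0))) =>
  [i /andP[]|none].
  by exists i.
case/eqP: nz; apply: big1 => i _; have := none i.
by move/negbT; rewrite negb_and !negbK => /orP[]/eqP->;
  rewrite ?conjC0 ?mulr0 ?mul0r.
Qed.

Lemma constituent_cfdot_neq0 phi psi i :
    phi \is a character -> psi \is a character ->
  '[phi, 'chi_i] != 0 -> '[psi, 'chi_i] != 0 -> '[phi, psi] != 0.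
Proof.
move=> Cphi Cpsi nz1 nz2; rewrite cfdot_sum_irr (bigD1 i) //=.
have ge0 j : 0 <= '[phi, 'chi_j] * '[psi, 'chi_j]^*.
  by rewrite mulr_ge0 ?conjC_ge0 ?natr_ge0 // Cnat_cfdot_char_irr.
rewrite gt_eqF // ltr_pwDl ?sumr_ge0 //.
by rewrite lt_def ge0 mulf_neq0 // conjC_eq0.
Qed.

Lemma constituent_sub phi psi i :
    phi \is a character -> psi - phi \is a character ->
  '[phi, 'chi_i] != 0 -> '[psi, 'chi_i] != 0.
Proof.
move=> Cphi Cpsi nz; rewrite -(subrK phi psi) cfdotDl gt_eqF //.
rewrite ltr_wpDl ?natr_ge0 ?Cnat_cfdot_char_irr //.
by rewrite lt_def nz natr_ge0 ?Cnat_cfdot_char_irr.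
Qed.

End Constituents.

Section HookShapes.

Variable n : nat.

Lemma is_partition_hook k : (k < n)%N -> is_partition n (hook n k).
Proof.
move=> ltkn; rewrite /is_partition /hook /= sumn_nseq mul1n subnK ?(ltnW ltkn)
  // eqxx andbT.
rewrite inE negb_or eq_sym subn_eq0 -ltnNge ltkn mem_nseq andbF andbT.
have : (1 <= n - k)%N by rewrite subn_gt0.
elim: k {ltkn} (n - k)%N => //= k IH a a0.
by rewrite a0 IH.
Qed.

Lemma size_hook k : size (hook n k) = k.+1.
Proof. by rewrite /= size_nseq. Qed.

Lemma hook_inj : injective (hook n).
Proof. by move=> k k' /(congr1 size); rewrite !size_hook => -[]. Qed.

Lemma part_hook k (i : 'I_(size (hook n k))) :
  part i = if i == 0%N :> nat then (n - k)%N else 1%N.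
Proof.
case: i => -[|i] lti //=; rewrite /part /= nth_nseq.
by move: lti; rewrite /= size_nseq ltnS => ->.
Qed.

Lemma specht_row_cfdot la (la_part : is_partition n la) :
  '[word_char pred0 (row_word la_part), specht_char n la] = 1.
Proof.
rewrite (specht_jacobi_trudi la_part) cfdotC -jt_char1 jt_det_cfdot // eqxx.
by rewrite conjC1.
Qed.

Lemma specht_col_cfdot la (la_part : is_partition n la) :
  '[word_char predT (col_word n la), specht_char n la] = 1.
Proof.
rewrite (specht_jacobi_trudi la_part) cfdotC /jt_det cfdot_suml (bigD1 1%g)
  //= big1 => [|w nw].
  by rewrite odd_perm1 scale1r (jt_char_col la_part) eqxx addr0 conjC1.
by rewrite cfdotZl (jt_char_col la_part) (negPf nw) mulr0.
Qed.

Lemma row_col_cfdot_neq0 la mu (la_part : is_partition n la) (mu_part :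
  is_partition n mu) :
    specht_char n la = specht_char n mu ->
  '[word_char pred0 (row_word la_part), word_char predT (col_word n mu)] != 0.
Proof.
move=> eqs; have [/irrP[i Di] _] := specht_char_spec la_part.
apply: (constituent_cfdot_neq0 (i := i)); try exact: word_char_is_char.
  by rewrite -Di specht_row_cfdot oner_neq0.
by rewrite -Di eqs specht_col_cfdot // oner_neq0.
Qed.

(** If the two Specht characters agree, the row character of one and the
    column character of the other have a common constituent. *)
Lemma row_col_matrix la mu (la_part : is_partition n la) (mu_part :
  is_partition n mu) :
    specht_char n la = specht_char n mu ->
  exists M : 'I_(size la) -> 'I_n -> nat,
    [/\ forall i j, (M i j <= 1)%N, forall i, (\sum_j M i j = part i)%N
      & forall j, (\sum_i M i j = \sum_(i : 'I_(size mu)) (j < part i))%N].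
Proof.
move/(row_col_cfdot_neq0 la_part mu_part);
  rewrite word_char_cfdot pnatr_eq0 -lt0n.
case/card_gt0P=> c; rewrite inE => /andP[/existsP[Z /and3P[/eqP <- /eqP ZR
  /eqP ZC]] /forallP le1].
exists (fun i j => content Z (i, j) : nat); split=> [i j|i|j].
- by have := le1 (i, j); rewrite /mixed /=.
- by rewrite -content_fst ZR row_content.
by rewrite -content_snd ZC (col_content mu_part).
Qed.

(** The first column of one matrix given by row_col_matrix shows that la has
    more than k rows, and the first row of the other one shows that its first
    part is at least n - k. A partition of n with both properties is the hook.
    *)
Lemma specht_eq_hook la k : (k < n)%N -> is_partition n la ->
  specht_char n la = specht_char n (hook n k) -> la = hook n k.
Proof.
move=> ltkn la_part eqs; have hk_part := is_partition_hook ltkn.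
have n_gt0 : (0 < n)%N := leq_ltn_trans (leq0n k) ltkn.
have [M [M1 _ Mc]] := row_col_matrix la_part hk_part eqs.
have [M' [M'1 M'r M'c]] := row_col_matrix hk_part la_part (esym eqs).
have size_la : (k < size la)%N.
  have := Mc (Ordinal n_gt0); rewrite [RHS](eq_bigr (fun=> 1%N)) => [eqM|i _];
    last first.
    by apply/eqP; rewrite eqb1; apply: (part_gt0 hk_part i).
  rewrite sum_nat_const card_ord muln1 size_hook in eqM; rewrite -eqM.
  by rewrite -[X in (_ <= X)%N]card_ord -sum1_card leq_sum.
have l_gt0 : (0 < size la)%N := leq_ltn_trans (leq0n k) size_la.
pose o : 'I_(size la) := Ordinal l_gt0.
have part0 : (n - k <= part o)%N.
  have := M'r (Ordinal (ltn0Sn _)); rewrite part_hook /= => <-.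
  rewrite -(sum_ltn_ord (part_bound la_part o)); apply: leq_sum => j _.
  case: ltnP => [_|gej]; first exact: M'1.
  have /eqP := M'c j; rewrite [X in _ == X]big1 => [|i _]; last first.
    by rewrite ltnNge (leq_trans (part_decr la_part _) gej).
  by rewrite sum_nat_eq0 => /forallP/(_ (Ordinal (ltn0Sn _)))/eqP ->.
have ones (i : 'I_(size la)) : (0 < i)%N -> part i = 1%N.
  move=> i0; have := part_gt0 la_part i;
    rewrite leq_eqVlt => /predU1P[//|part2].
  have := part_sum la_part; rewrite (bigD1 o) //= (bigD1 i) /=; last
    by rewrite -val_eqE /= -lt0n.
  have : (\sum_(j | (j != o) && (j != i)) 1
    <= \sum_(j | (j != o) && (j != i)) part j)%N.
    by apply: leq_sum => j _; apply: part_gt0 la_part j.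
  have : (\sum_(j : 'I_(size la)) 1 = size la)%N by rewrite sum1_card card_ord.
  rewrite (bigD1 o) //= (bigD1 i) /=; last by rewrite -val_eqE /= -lt0n.
  move: part0 size_la part2 ltkn; lia.
have [k' ltk' Dla] := hook_of_ones n_gt0 la_part ones.
have le' : (k <= k')%N by move: size_la; rewrite Dla size_hook ltnS.
have := part0; rewrite /part /= Dla /= => leP; congr hook.
by apply/eqP; move: ltk' leP le'; lia.
Qed.

End HookShapes.

(** * Induction of trivial times sign from a two-part Young subgroup *)

Section TwoLetters.

Variable n : nat.
Local Notation word := {ffun 'I_n -> bool}.
Implicit Types (F : word) (j k : nat).

Definition ones F := #|[set x | F x]|.

Lemma content_true F : content F true = ones F :> nat.
Proof. by rewrite contentE; apply: eq_card => x; rewrite !inE eqb_id. Qed.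

Lemma content_bool F : (content F true + content F false = n)%N.
Proof. by rewrite -[RHS](content_sum F) big_bool. Qed.

Lemma eq_content_bool F F' : (content F' == content F) = (ones F' == ones F).
Proof.
rewrite -!content_true; apply/eqP/eqP=> [-> //|e].
apply/ffunP=> -[]; apply/val_inj => //=.
by apply: (@addnI (content F' true)); rewrite content_bool e content_bool.
Qed.

Definition marker j : word := [ffun x : 'I_n => (x < j)%N].

Lemma ones_marker j : (j <= n)%N -> ones (marker j) = j.
Proof.
move=> lejn; rewrite /ones -sum1_card -[RHS](sum_ltn_ord lejn) big_mkcond /=.
by apply: eq_bigr => x _; rewrite inE ffunE; case: (x < j)%N.
Qed.

(** The character induced from the trivial character times the sign of S_(n-j)
    x S_j: the sign is on the letter true, which the word carries j times. *)
Definition mixed_hook j : 'CF([set: 'S_n]) := word_char id (marker j).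

Lemma mixed_hook_char j : mixed_hook j \is a character.
Proof. exact: word_char_is_char. Qed.

Lemma mixed_hookE F : word_char id F = mixed_hook (ones F).
Proof.
have leF : (ones F <= n)%N by rewrite -content_true -ltnS ltn_ord.
by apply: eq_content_char; apply/eqP; rewrite eq_content_bool ones_marker.
Qed.

Lemma jointP (F F' : word) (c : {ffun bool * bool -> 'I_n.+1}) :
    c \in joint_contents id id F F' ->
  [/\ (c (true, false) <= 1)%N, (c (false, true) <= 1)%N,
      (c (true, true) + c (true, false) = ones F)%N,
      (c (true, true) + c (false, true) = ones F')%N &
      (c (true, true) + c (true, false) + (c (false, true) + c (false,
        false)) = n)%N].
Proof.
rewrite inE => /andP[/existsP[Z /and3P[/eqP <- /eqP ZF /eqP ZF']] /forallP le1].
have := le1 (true, false); have := le1 (false, true);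
  rewrite /mixed /= => -> ->.
have := content_fst Z true; have := content_fst Z false;
  have := content_snd Z true.
rewrite ZF ZF' !big_bool !content_true => <- <- eqF; split=> //.
by rewrite -[RHS](content_bool F) content_true eqF.
Qed.

(** A 2 x 2 matrix with given row and column sums is determined by one entry,
    which here is 0 or 1. *)
Lemma card_joint_le (F F' : word) (b : pred bool) :
    (forall c, c \in joint_contents id id F F' -> b (0 < c (true, false))%N) ->
  (#|joint_contents id id F F'| <= #|b|)%N.
Proof.
move=> Hb; rewrite -(card_in_imset (f :=
  fun c : {ffun bool * bool -> 'I_n.+1} => (0 < c (true, false))%N)).
  by apply: subset_leq_card; apply/subsetP=> _ /imsetP[c Jc ->]; apply: Hb.
move=> c c' /jointP[H1 H2 H3 H4 H5] /jointP[H1' H2' H3' H4' H5'] e.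
have etf : c (true, false) = c' (true, false) :> nat.
  by move: e H1 H1'; case: (c _ : nat) => [|[]] //; case: (c' _ : nat) => [|[]].
have ett : c (true, true) = c' (true, true) :> nat.
  by apply: (@addIn (c (true, false))); rewrite H3 etf H3'.
have eft : c (false, true) = c' (false, true) :> nat.
  by apply: (@addnI (c (true, true))); rewrite H4 ett H4'.
have eff : c (false, false) = c' (false, false) :> nat.
  apply: (@addnI (c (false, true)));
    apply: (@addnI (c (true, true) + c (true, false))%N).
  by rewrite H5 ett etf eft H5'.
by apply/ffunP=> -[[] []]; apply/val_inj.
Qed.

Lemma mixed_hook_norm j : (j <= n)%N ->
  '[mixed_hook j] <= (if (0 < j < n)%N then 2 else 1).
Proof.
move=> lejn; rewrite /mixed_hook word_char_cfdot.
have -> : (if (0 < j < n)%N then 2 else 1)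
  = (if (0 < j < n)%N then 2 else 1)%N%:R :> algC.
  by case: ifP.
rewrite ler_nat; case: ifP => [_|nj].
  by rewrite -card_bool; apply: card_joint_le.
rewrite -(card1 false); apply: card_joint_le => c /jointP[H1 H2 H3 H4 H5].
rewrite inE eqbF_neg -eqn0Ngt; rewrite !ones_marker // in H3 H4.
by move: nj H1 H2 H3 H4 H5; move: (nat_of_ord (c _)) (nat_of_ord (c _))
  (nat_of_ord (c _)) (nat_of_ord (c _)); lia.
Qed.

Lemma card_letters (T : finType) (F : {ffun 'I_n -> T}) (e : pred T) :
  #|[set x | e (F x)]| = (\sum_(a | e a) content F a)%N.
Proof.
rewrite -sum1_card (partition_big F e) => [|x]; last by rewrite inE.
apply: eq_bigr => a ea; rewrite contentE -sum1_card; apply: eq_bigl => x.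
by rewrite !inE; case: eqP => [->|_]; rewrite ?ea ?andbF.
Qed.

Section Hook.

Variable k : nat.
Hypothesis ltkn : (k < n)%N.

Local Notation hk_part := (is_partition_hook ltkn).
Local Notation R := (row_word hk_part).
Local Notation C := (col_word n (hook n k)).

Definition low_rows : word := [ffun x => (0 < R x)%N].
Definition first_col : word := [ffun x => C x == 0%N :> nat].

Lemma row_gt0_col x : (0 < R x)%N -> C x = 0%N :> nat.
Proof.
move=> R0; have := tableau_content hk_part (R x) (C x).
rewrite part_hook (gtn_eqF R0); case: ltnP => [|_ /eqP]; first
  by rewrite ltnS leqn0 => /eqP.
rewrite contentE cards_eq0 => /eqP/setP/(_ x); rewrite !inE ffunE.
by rewrite eqxx.
Qed.

Lemma low_rows_inj x y : (0 < R x)%N -> R x = R y -> x = y.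
Proof.
move=> R0 e; apply: (row_col_inj (la_part := hk_part)) => //;
  apply/val_inj => /=.
by rewrite row_gt0_col // row_gt0_col -?e.
Qed.

Lemma high_cols_inj x y : (0 < C x)%N -> C x = C y -> x = y.
Proof.
move=> C0 e; apply: (row_col_inj (la_part := hk_part)) => //;
  apply/val_inj => /=.
have row0 z : (0 < C z)%N -> R z = 0%N :> nat.
  by move=> Cz; apply/eqP; rewrite -leqn0 leqNgt;
    apply/negP=> /row_gt0_col e0; rewrite e0 in Cz.
by rewrite !row0 // -e.
Qed.

Lemma ones_low_rows : ones low_rows = k.
Proof.
transitivity (\sum_(i : 'I_(size (hook n k)) | (0 < i)%N) content R i)%N.
  by rewrite -card_letters; apply: eq_card => x; rewrite !inE ffunE.
rewrite (eq_bigr (fun=> 1%N)) => [|i i0]; last first.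
  by rewrite row_content part_hook (gtn_eqF i0).
suff card_pos L : L = k.+1 -> (\sum_(i < L | (0 < i)%N) 1 = k)%N.
  exact: card_pos (size_hook n k).
move=> ->; rewrite sum1_card -[RHS]/(k.+1.-1) -[in RHS](card_ord k.+1)
  -(cardC1 (ord0 : 'I_k.+1)).
by apply: eq_card => i; rewrite [RHS]inE -val_eqE -lt0n.
Qed.

Lemma ones_first_col : ones first_col = k.+1.
Proof.
have n_gt0 : (0 < n)%N := leq_ltn_trans (leq0n k) ltkn.
transitivity (content C (Ordinal n_gt0) : nat).
  by rewrite contentE; apply: eq_card => x; rewrite !inE ffunE.
rewrite (col_content hk_part) (eq_bigr (fun=> 1%N)) => [|i _].
  by rewrite sum1_card card_ord size_hook.
by apply/eqP; rewrite eqb1; apply: (part_gt0 hk_part i).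
Qed.

(** The row stabiliser of the hook is contained in the stabiliser of low_rows,
    and fixes all cells below the first row. *)
Lemma mixed_hook_row : word_char pred0 R - mixed_hook k \is a character.
Proof.
have -> : mixed_hook k = word_char id low_rows
  by rewrite mixed_hookE ones_low_rows.
apply: indlin_sub; first exact: word_parityM.
  apply/subsetP=> s /word_stabP Rs; apply/word_stabP=> x.
  by rewrite ![low_rows _]ffunE Rs.
move=> s Rs; rewrite word_parity0 /word_parity (_ : restr_perm _ _
  = 1%g) ?odd_perm1 //.
apply/permP=> x; rewrite perm1.
have [Bx|Bx] := boolP (x \in marked id low_rows);
  last exact: (out_perm (restr_perm_on _ _)).
have stabs : s \in word_stab low_rows.
  by apply/word_stabP=> y; rewrite ![low_rows _]ffunE (word_stabP _ _ Rs).
rewrite restr_permE ?word_stab_marked //.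
rewrite inE [low_rows x]ffunE in Bx.
by apply/esym/low_rows_inj => //; rewrite (word_stabP _ _ Rs).
Qed.

(** The column stabiliser of the hook is contained in the stabiliser of
    first_col, and fixes all cells outside the first column. *)
Lemma mixed_hook_col : word_char predT C - mixed_hook k.+1 \is a character.
Proof.
have -> : mixed_hook k.+1 = word_char id first_col
  by rewrite mixed_hookE ones_first_col.
apply: indlin_sub; first exact: word_parityM.
  apply/subsetP=> s /word_stabP Cs; apply/word_stabP=> x.
  by rewrite ![first_col _]ffunE Cs.
move=> s Cs; rewrite word_parityT /word_parity (_ : restr_perm _ _ = s) //.
have stabs : s \in word_stab first_col.
  by apply/word_stabP=> y; rewrite ![first_col _]ffunE (word_stabP _ _ Cs).
apply/permP=> x; have [Bx|Bx] := boolP (x \in marked id first_col).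
  by rewrite restr_permE ?word_stab_marked.
rewrite (out_perm (restr_perm_on _ _)) //.
rewrite inE [first_col x]ffunE -lt0n in Bx.
by apply/high_cols_inj => //; rewrite (word_stabP _ _ Cs).
Qed.

(** The words low_rows and first_col differ in the corner cell only, so their
    joint content has a single mixed unit. *)
Lemma mixed_hook_succ : '[mixed_hook k, mixed_hook k.+1] != 0.
Proof.
have -> : mixed_hook k = word_char id low_rows
  by rewrite mixed_hookE ones_low_rows.
have -> : mixed_hook k.+1 = word_char id first_col
  by rewrite mixed_hookE ones_first_col.
rewrite word_char_cfdot pnatr_eq0 -lt0n.
apply/card_gt0P; exists (content (word_pair low_rows first_col)); rewrite inE.
apply/andP; split.
  by apply/existsP; exists (word_pair low_rows first_col);
    rewrite word_fst_pair word_snd_pair !eqxx.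
apply/forallP=> -[a b]; apply/implyP; rewrite /mixed /= contentE => ab.
apply/card_le1_eqP=> x y; rewrite !inE ![word_pair _ _ _]ffunE !xpair_eqE
  ![low_rows _]ffunE ![first_col _]ffunE.
case: a b ab => -[] //= _.
  by case/andP=> /eqP Rx /eqP; rewrite (row_gt0_col Rx).
case/andP=> /eqP Rx /eqP/eqP Cx /andP[/eqP Ry /eqP/eqP Cy].
have row0 z : (0 < R z)%N = false -> R z = 0%N :> nat by case: (R z : nat).
by apply: (row_col_inj (la_part := hk_part)); apply: ord_inj;
  [rewrite (row0 x Rx) (row0 y Ry) | rewrite Cx Cy].
Qed.

End Hook.

End TwoLetters.

(** * The generating function of the hook characters *)

Section HookGenerating.

Variable n : nat.
Implicit Types (j k : nat) (s : 'S_n).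

Local Notation theta k := (specht_char n (hook n k)).

Lemma hook_irr k : (k < n)%N -> theta k \in irr [set: 'S_n].
Proof. by move=> ltkn; case: (specht_char_spec (is_partition_hook ltkn)). Qed.

Lemma hook_orth j k : (j < n)%N -> (k < n)%N ->
  '[theta j, theta k] = (j == k)%:R.
Proof.
move=> ltjn ltkn; have [->|njk] := eqVneq j k; first
  by rewrite irrWnorm ?hook_irr.
have /irrP[i Di] := hook_irr ltjn; have /irrP[i' Di'] := hook_irr ltkn.
rewrite Di Di' cfdot_irr; case: eqP => // ei; case/eqP: njk.
apply: hook_inj; apply: (specht_eq_hook ltkn); first exact: is_partition_hook.
by rewrite Di Di' ei.
Qed.

(** A common constituent of the two is, by mixed_hook_row and mixed_hook_col,
    also one of the two induced characters that determine the hook character.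
    *)
Lemma mixed_hook_constituents k : (k < n)%N ->
  '[mixed_hook n k, theta k] != 0 /\ '[mixed_hook n k.+1, theta k] != 0.
Proof.
move=> ltkn; have [i [nz1 nz2]] := common_constituent (mixed_hook_succ ltkn).
have [_ uniq] := specht_char_spec (is_partition_hook ltkn).
rewrite -(uniq i); first by split.
  exact: constituent_sub (mixed_hook_char _ _) (mixed_hook_row ltkn) nz1.
exact: constituent_sub (mixed_hook_char _ _) (mixed_hook_col ltkn) nz2.
Qed.

(** Two distinct irreducible constituents exhaust a norm at most 2; for j = 0
    and j = n the norm is 1 and there is only one. *)
Lemma mixed_hook_pieri j : (0 < n)%N -> (j <= n)%N ->
  mixed_hook n j = (if (j < n)%N then theta j else 0)
                    + (if (0 < j)%N then theta j.-1 else 0).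
Proof.
move=> n_gt0 lejn; have Cm := mixed_hook_char n.
have Ct k : (k < n)%N -> theta k \is a character by move/hook_irr/irrWchar.
have nat1 k : (k < n)%N -> exists a b, [/\ '[mixed_hook n k, theta k] = a.+1%:R,
    '[theta k, mixed_hook n k] = a.+1%:R, '[mixed_hook n k.+1, theta k]
      = b.+1%:R
    & '[theta k, mixed_hook n k.+1] = b.+1%:R].
  move=> ltkn; have [nz1 nz2] := mixed_hook_constituents ltkn.
  rewrite -!(cfdotC_char (Cm _) (Ct _ ltkn)).
  have /natrP[[|a] Da] := Cnat_cfdot_char (Cm k) (Ct _ ltkn); first
    by rewrite Da eqxx in nz1.
  have /natrP[[|b] Db] := Cnat_cfdot_char (Cm k.+1) (Ct _ ltkn); first
    by rewrite Db eqxx in nz2.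
  by exists a, b.
have norm0 (phi : 'CF([set: 'S_n])) : '[phi] <= 0 -> phi = 0.
  by move=> le0; apply/eqP; rewrite -cfnorm_eq0 eq_le le0 cfnorm_ge0.
have /natrP[N DN] := Cnat_cfdot_char (Cm j) (Cm j).
have := mixed_hook_norm lejn; rewrite DN.
have [ltjn|gejn] := ltnP j n; have [j0|j0] := ltnP 0 j; rewrite /= ?andbF.
- have ltj1 : (j.-1 < n)%N := leq_ltn_trans (leq_pred j) ltjn.
  have [a [_ [Da Da' _ _]]] := nat1 _ ltjn; have [_ [b [_ _]]] := nat1 _ ltj1.
  rewrite prednK // => Db Db' le2; apply/eqP; rewrite -subr_eq0;
    apply/eqP/norm0.
  rewrite cfdotBl !cfdotBr !cfdotDl !cfdotDr !hook_orth // !eqxx DN Da Da' Db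
    Db'.
  have -> : (j == j.-1) = false by apply/eqP; lia.
  have -> : (j.-1 == j) = false by apply/eqP; lia.
  rewrite [X in X <= _](_ : _ = N%:R - (a + a + b + b + 2)%:R); last
    by rewrite !natrD -?[a.+1%:R]natr1 -?[b.+1%:R]natr1 ?mulr1n ?mulr0n; ring.
  by rewrite subr_le0 (le_trans le2) // (ler_nat _ 2) leq_addl.
- have [a [_ [Da Da' _ _]]] := nat1 _ ltjn; rewrite addr0 => le1.
  apply/eqP; rewrite -subr_eq0; apply/eqP/norm0.
  rewrite cfdotBl !cfdotBr hook_orth // eqxx DN Da Da'.
  rewrite [X in X <= _](_ : _ = N%:R - (a + a + 1)%:R); last
    by rewrite !natrD -?[a.+1%:R]natr1 -?[b.+1%:R]natr1 ?mulr1n ?mulr0n; ring.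
  by rewrite subr_le0 (le_trans le1) // (ler_nat _ 1) leq_addl.
- have ltj1 : (j.-1 < n)%N by rewrite prednK.
  have [_ [b [_ _]]] := nat1 _ ltj1; rewrite prednK // => Db Db'.
  rewrite add0r => le1; apply/eqP; rewrite -subr_eq0; apply/eqP/norm0.
  rewrite cfdotBl !cfdotBr hook_orth // eqxx DN Db Db'.
  rewrite [X in X <= _](_ : _ = N%:R - (b + b + 1)%:R); last
    by rewrite !natrD -?[a.+1%:R]natr1 -?[b.+1%:R]natr1 ?mulr1n ?mulr0n; ring.
  by rewrite subr_le0 (le_trans le1) // (ler_nat _ 1) leq_addl.
by move: n_gt0; rewrite ltnNge (leq_trans gejn j0).
Qed.

(** The words fixed by s are given by sets of cycles of s, and both the sign
    and the number of marked positions are multiplicative over the cycles. *)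
Lemma mixed_hook_gen s :
  \sum_(j < n.+1) mixed_hook n j s *: 'X^j
    = \prod_(O in porbits s) (1 - (- 'X) ^+ #|O|) :> {poly algC}.
Proof.
pose sgnX (O : {set 'I_n}) : {poly algC} := - (- 'X) ^+ #|O|.
(* Extending the factors by 1 outside the cycles allows expanding over all
   sets of sets of positions. *)
pose fac O := if O \in porbits s then sgnX O else 0.
have -> : \prod_(O in porbits s) (1 - (- 'X) ^+ #|O|) = \prod_O (fac O + 1)
  :> {poly algC}.
  rewrite big_mkcond; apply: eq_bigr => O _; rewrite /fac.
  by case: ifP => _; rewrite ?add0r // addrC.
rewrite bigA_distr.
rewrite (bigID (fun J : {set {set 'I_n}} =>
  J \subset porbits s)) /= [X in _ + X]big1 ?addr0; last first.
  move=> J /subsetPn[O JO nO]; rewrite (bigD1 O) //= JO /fac (negPf nO).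
  by rewrite mul0r.
transitivity (\sum_(F : {ffun 'I_n ->
  bool}) word_sign id F s *: 'X^(ones F) : {poly algC}).
  rewrite (partition_big (fun F : {ffun 'I_n ->
    bool} => inord (ones F) : 'I_n.+1) predT) //=.
  apply: eq_bigr => j _; rewrite word_charE scaler_suml.
  have lejn : (j <= n)%N by rewrite -ltnS.
  apply: eq_big => F.
    rewrite eq_content_bool ones_marker // -val_eqE /= inordK //.
    by rewrite -content_true ltn_ord.
  by rewrite eq_content_bool ones_marker // => /eqP->.
rewrite (bigID (fun F : {ffun 'I_n ->
  bool} => s \in word_stab F)) /= [X in _ + X]big1 ?addr0; last first.
  by move=> F /negPf nF; rewrite /word_sign nF scale0r.
pose Fw (J : {set {set 'I_n}}) : {ffun 'I_n -> bool} :=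
  [ffun x => porbit s x \in J].
pose Jw (F : {ffun 'I_n -> bool}) :=
  [set O in porbits s | O \subset marked id F].
have FwK (J : {set {set 'I_n}}) : J \subset porbits s -> Jw (Fw J) = J.
  move=> sJ; apply/setP=> O; rewrite inE; apply/andP/idP=> [[sO sub]|JO].
    case/imsetP: sO sub => x _ -> sub.
    by have := subsetP sub x (porbit_id s x); rewrite inE ffunE.
  split; first exact: (subsetP sJ).
  apply/subsetP=> x xO; rewrite inE ffunE.
  case/imsetP: (subsetP sJ _ JO) => y _ Dy; rewrite Dy in xO JO *.
  by move: xO; rewrite -eq_porbit_mem => /eqP ->.
have stabFw (J : {set {set 'I_n}}) : s \in word_stab (Fw J).
  by apply/word_stabP=> x; rewrite !ffunE; have := porbit_perm s 1 x;
    rewrite expg1 => ->.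
rewrite (reindex_onto Fw Jw) /=; last first.
  move=> F Fs; apply/ffunP=> x; rewrite ffunE inE imset_f //=.
  rewrite (sub_porbitE (word_stab_marked id Fs) (imset_f _ _) (porbit_id s x))
    //.
  by rewrite inE.
apply: eq_big => [J|J /andP[_ /eqP JE]].
  rewrite stabFw /=; apply/eqP/idP=> [<-|/FwK //].
  by apply/subsetP=> O; rewrite inE => /andP[].
have sJ : J \subset porbits s by rewrite -JE; apply/subsetP=> O;
  rewrite inE => /andP[].
rewrite /word_sign stabFw /word_parity sign_restr_perm ?word_stab_marked //.
rewrite -big_mkcond /=.
rewrite (eq_bigl (mem J)) => [|O]; last first.
  by transitivity (O \in Jw (Fw J)); [rewrite inE | rewrite JE].
have -> : ones (Fw J) = (\sum_(O in J) #|O|)%N.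
  rewrite /ones -sum1_card (partition_big (porbit s) (mem J)) /= => [|x];
    last first.
    by rewrite inE ffunE.
  apply: eq_bigr => O JO; case/imsetP: (subsetP sJ _ JO) => y _ Dy.
  rewrite -sum1_card; apply: eq_bigl => x; rewrite inE ffunE Dy eq_porbit_mem.
  by rewrite andb_idl // -eq_porbit_mem -Dy => /eqP ->.
rewrite -prodrXr -mul_polyC rmorph_prod -big_split /=; apply: eq_bigr => O JO.
by rewrite /fac (subsetP sJ) // /sgnX [in RHS]exprNn polyCN rmorph_sign mulNr.
Qed.

End HookGenerating.

Section HookValues.

Variable n : nat.
Hypothesis n_gt0 : (0 < n)%N.
Implicit Types (k : nat) (s : 'S_n).

Local Notation theta k := (specht_char n (hook n k)).

Lemma hook_gen s :
  (1 + 'X) * (\sum_(k < n) theta k s *: 'X^k)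
    = \prod_(O in porbits s) (1 - (- 'X) ^+ #|O|) :> {poly algC}.
Proof.
rewrite -mixed_hook_gen.
rewrite (eq_bigr (fun j : 'I_n.+1 =>
  (if (j < n)%N then theta j s *: 'X^j else 0)
    + (if (0 < j)%N then theta j.-1 s *: 'X^j else 0) : {poly algC})) =>
      [|j _]; last first.
  have lejn : (j <= n)%N by rewrite -ltnS.
  rewrite mixed_hook_pieri // cfunE scalerDl.
  by congr (_ + _); case: ifP; rewrite ?cfunE ?scale0r.
rewrite big_split /= big_ord_recr /= ltnn addr0 big_ord_recl /= add0r mulrDl
  mul1r.
congr (_ + _); first by apply: eq_bigr => k _; rewrite ltn_ord.
rewrite mulr_sumr; apply: eq_bigr => k _.
by rewrite -scalerAr -exprS.
Qed.

Lemma horner_hook_sum s (q : algC) :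
  (\sum_(k < n) theta k s *: 'X^k).[q] = \sum_(k < n) theta k s * q ^+ k.
Proof. by rewrite horner_sum; apply: eq_bigr => k _;
  rewrite hornerZ hornerXn. Qed.

(** Evaluate hook_gen at 1, where the factor of an even cycle vanishes. *)
Lemma hook_sum_even s O : O \in porbits s -> ~~ odd #|O| ->
  \sum_(k < n) theta k s = 0.
Proof.
move=> sO evO; have := congr1 (horner^~ 1) (hook_gen s).
rewrite /= hornerM (bigD1 O) //= hornerM horner_hook_sum.
rewrite hornerD hornerX hornerC hornerD hornerC hornerN horner_exp hornerN
  hornerX.
rewrite -[X in 1 - X]signr_odd (negPf evO) subrr mul0r => /eqP.
rewrite mulf_eq0 (_ : 1 + 1 == 0 = false) ?(pnatr_eq0 _ 2) //= => /eqP e.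
by rewrite -[RHS]e; apply: eq_bigr => k _; rewrite expr1n mulr1.
Qed.

Lemma factor_orbit m : 1 - (- 'X) ^+ m
  = (1 + 'X) * \sum_(i < m) (- 'X) ^+ i :> {poly algC}.
Proof. by rewrite -opprB subrX1 -mulNr opprB opprK. Qed.

Lemma addX_neq0 : 1 + 'X != 0 :> {poly algC}.
Proof. by rewrite addrC -polyC1 -[_ + _]/('X + 1%:P) -size_poly_eq0
  size_XaddC. Qed.

(** Every cycle contributes a factor 1 + 'X to the right-hand side of
    hook_gen, so with two cycles one such factor is left after cancellation,
    and it vanishes at -1. *)
Lemma hook_altsum_orbits s : #|porbits s| != 1%N ->
  \sum_(k < n) (-1) ^+ k * theta k s = 0.
Proof.
move=> nO; have [O sO] : exists O, O \in porbits s.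
  by exists (porbit s (Ordinal n_gt0)); apply: imset_f.
have [O' sO' neO] : exists2 O', O' \in porbits s & O' != O.
  have : porbits s :\ O != set0.
    rewrite -card_gt0; have := cardsD1 O (porbits s); rewrite sO => e.
    by rewrite e add1n eqSS -lt0n in nO.
  by case/set0Pn=> O'; rewrite !inE => /andP[ne sO']; exists O'.
have := hook_gen s; rewrite (bigD1 O) //= factor_orbit -mulrA.
move/(mulfI addX_neq0); rewrite (bigD1 O') /=; last by rewrite sO' neO.
move/(congr1 (horner^~ (-1))); rewrite /= factor_orbit !hornerM horner_hook_sum.
rewrite !(hornerD, hornerC, hornerX) subrr !(mul0r, mulr0) => e.
by rewrite -[RHS]e; apply: eq_bigr => k _; rewrite mulrC.
Qed.

Lemma polyC_sign i : ((-1) ^+ i)%:P = (-1) ^+ i :> {poly algC}.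
Proof. by rewrite rmorph_sign. Qed.

(** After cancellation of 1 + 'X, hook_gen is the product of 1 - (- 'X)^m by a
    truncated geometric series. *)
Lemma hook_two_orbits s (O1 O2 : {set 'I_n}) (m k : nat) :
    porbits s = [set O1; O2] -> O1 != O2 -> #|O1| = m -> #|O2| = m ->
      (k < m + m)%N -> n = (m + m)%N ->
  theta k s = if (k < m)%N then (-1) ^+ k else (-1) ^+ k.+1.
Proof.
move=> sO neO c1 c2 ltk Dn; have := hook_gen s.
rewrite sO big_setU1 ?inE //= big_set1 c1 c2 {1}factor_orbit -mulrA =>
  /(mulfI addX_neq0).
move/(congr1 (coefp k)); rewrite /= coef_sum.
have ltkn : (k < n)%N by rewrite Dn.
rewrite (bigD1 (Ordinal ltkn)) //= coefZ coefXn eqxx mulr1 big1 ?addr0 =>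
  [-> |i ni]; last first.
  by rewrite coefZ coefXn eq_sym -[_ == _]/(i == Ordinal ltkn) (negPf ni) mulr0.
rewrite mulrBr mulr1 coefB.
have geoE (p : nat) : (\sum_(i < m) (- 'X) ^+ i : {poly algC})`_p
  = if (p < m)%N then (-1) ^+ p else 0.
  have cX i : ((- 'X) ^+ i : {poly algC})`_p = if p == i then (-1) ^+ p else 0.
    rewrite (exprNn 'X) -polyC_sign coefCM coefXn.
    by case: eqP => [->|_]; rewrite ?mulr1 ?mulr0.
  rewrite coef_sum; case: ifP => [lt|ge].
    rewrite (bigD1 (Ordinal lt)) //= cX eqxx big1 ?addr0 // => i ni.
    by rewrite cX eq_sym -[_ == _]/(i == Ordinal lt) (negPf ni).
  by rewrite big1 // => i _; rewrite cX; case: eqP => // e;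
    rewrite e ltn_ord in ge.
rewrite [in X in _ - X]exprNn -[in X in _ - X](rmorph_sign polyC) mulrA
  coefMXn [in X in _ - X]mulrC coefCM !geoE.
case: ltnP => [lt|ge]; first by rewrite subr0.
rewrite (_ : (k - m < m)%N) ?ltn_subLR // sub0r -exprD subnKC // exprS mulN1r
  //.
Qed.

(** The constant term of hook_gen. *)
Lemma hook0E s : theta 0 s = 1.
Proof.
have := congr1 (horner^~ 0) (hook_gen s); rewrite /= hornerM horner_hook_sum.
rewrite !(hornerD, hornerC, hornerX) addr0 mul1r (bigD1 (Ordinal n_gt0)) //=
  mulr1 big1 ?addr0.
  move=> ->; rewrite horner_prod big1 // => O /imsetP[x _ ->].
  by rewrite !(hornerD, hornerC, hornerN, horner_exp,
    hornerX) oppr0 expr0n (negPf (card_porbit_neq0 _ _)) subr0.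
move=> k nk; rewrite expr0n (_ : (k == 0 :> nat)%N = false) ?mulr0 //.
by apply: negbTE; move: nk; rewrite -val_eqE.
Qed.

End HookValues.

(** * Cycle structure of squares *)

Section Squares.

Variable n : nat.
Implicit Types (s t : 'S_n) (la : seq nat).

Lemma cycle_type_two s m : cycle_type s = [:: m; m] -> exists O1 O2,
  [/\ porbits s = [set O1; O2], O1 != O2, #|O1| = m & #|O2| = m].
Proof.
rewrite /cycle_type => ct; set c := [seq _ | _ <- _] in ct.
have Hc : perm_eq c [:: m; m] by rewrite -ct perm_sym perm_sort.
have card2 : #|porbits s| == 2 by have := perm_size Hc;
  rewrite size_map -cardE => ->.
have /cards2P[O1 [O2 [neO sO]]] := card2.
have cardO O : O \in porbits s -> #|O| = m.
  move=> sO'; have : #|O| \in c by apply/mapP; exists O; rewrite ?mem_enum.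
  by rewrite (perm_mem Hc) !inE orbb => /eqP.
by exists O1, O2; split=> //; apply: cardO; rewrite sO !inE eqxx ?orbT.
Qed.

(** The powers of s move x0 into the orbit of x0 or of s x0 under the square
    of s, and these have at most m elements since the m-th power of the square
    is trivial. *)
Lemma sqr_cycle_two s m : (0 < m)%N -> n = m.*2 -> #|porbits s| = 1%N ->
  exists O1 O2,
  [/\ porbits (s ^+ 2)%g = [set O1; O2], O1 != O2, #|O1| = m & #|O2| = m].
Proof.
move=> m_gt0 Dn one.
have n_gt0 : (0 < n)%N by rewrite Dn double_gt0.
pose x0 := Ordinal n_gt0; set r := (s ^+ 2)%g.
have full x : porbit s x0 = [set: 'I_n] /\ x \in porbit s x0.
  have /cards1P[O DO] : #|porbits s| == 1%N by rewrite one.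
  have e y : porbit s y = O by apply/set1P; rewrite -DO; apply: imset_f.
  have memO y : y \in O by rewrite -(e y) porbit_id.
  by rewrite e; split=> //; apply/setP=> y; rewrite inE memO.
have cardx0 : #|porbit s x0| = n by rewrite (full x0).1 cardsT card_ord.
have rX i x : (r ^+ i)%g x = (s ^+ i.*2)%g x by rewrite -expgM mul2n.
pose O1 := porbit r x0; pose O2 := porbit r (s x0).
have cover x : x \in O1 \/ x \in O2.
  have /porbitP[i ->] := (full x).2.
  rewrite -(odd_double_half i); case: (odd i).
    by right; apply/porbitP; exists i./2; rewrite rX -permM -expgS add1n.
  by left; apply/porbitP; exists i./2; rewrite rX.
have cardO x : (#|porbit r x| <= m)%N.
  rewrite leqNgt; apply/negP=> lt.
  have cardx : #|porbit s x| = m.*2.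
    have : porbit s x = porbit s x0
      by apply/eqP; rewrite eq_porbit_mem; apply: (full x).2.
    by move=> ->; exact: etrans cardx0 Dn.
  have := uniq_traject_porbit r x; move/uniqP=> /(_ x 0%N m).
  rewrite !inE size_traject (leq_trans _ lt) // lt => /(_ isT isT).
  rewrite !nth_traject ?(leq_trans _ lt) // => e.
  have : 0%N = m.
    by apply: e; have := iter_porbit s x; rewrite cardx -permX -rX permX => ->.
  by move=> m0; rewrite -m0 in m_gt0.
have cardU : (n <= #|O1 :|: O2|)%N.
  rewrite -[X in (X <= _)%N]card_ord -cardsT subset_leq_card //;
    apply/subsetP=> x _.
  by rewrite inE; apply/orP; apply: cover.
have := cardO x0; have := cardO (s x0); rewrite -/O1 -/O2 => le2 le1.
have neO : O1 != O2.
  apply/eqP=> e; move: cardU; rewrite e setUid => le.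
  have := leq_trans le le2; rewrite Dn -addnn -[X in (_
    <= X)%N]addn0 leq_add2l leqn0.
  by move=> /eqP m0; rewrite m0 in m_gt0.
have leU : (m + m <= #|O1| + #|O2|)%N.
  by rewrite addnn -Dn (leq_trans cardU) // leq_card_setU.
have card1 : #|O1| = m.
  by apply/eqP; rewrite eqn_leq le1 -(leq_add2r m) (leq_trans leU) // leq_add2l.
have card2 : #|O2| = m.
  by apply/eqP; rewrite eqn_leq le2 -(leq_add2l m) (leq_trans leU) // leq_add2r.
exists O1, O2; split=> //; apply/setP=> X; rewrite !inE.
apply/imsetP/orP=> [[x _ ->]|[]/eqP->]; [|by exists x0|by exists (s x0)].
by rewrite !eq_porbit_mem; apply: cover.
Qed.

Lemma specht_char_conj la s : is_partition n la ->
  (specht_char n la s)^* = specht_char n la s.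
Proof.
move=> la_part; rewrite (specht_jacobi_trudi la_part) /jt_det sum_cfunE
  rmorph_sum.
apply: eq_bigr => w _; rewrite cfunE rmorphM rmorph_sign jt_charE //.
by rewrite rmorph_nat.
Qed.

(** Such a permutation fixes the same words as its square, and these determine
    the value of the determinant. *)
Lemma specht_sqr_odd la s : is_partition n la ->
  (forall X, X \in porbits s -> odd #|X|) ->
    specht_char n la (s ^+ 2)%g = specht_char n la s.
Proof.
move=> la_part odds; rewrite (specht_jacobi_trudi la_part) /jt_det !sum_cfunE.
apply: eq_bigr => w _; rewrite !cfunE !jt_charE //; congr (_ * _%:R).
by apply: eq_card => F; rewrite [LHS]in_set [RHS]in_set (word_stab_sqr_odd F
  odds).
Qed.

End Squares.

(** * The scalar product with the hooks of even leg length *)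

Section Assembly.

Variable n : nat.
Hypothesis n_gt0 : (0 < n)%N.
Implicit Types (k : nat) (s : 'S_n) (la : seq nat).

Local Notation theta k := (specht_char n (hook n k)).

Lemma even_hook_charE : even_hook_char n = \sum_(k < n | ~~ odd k) theta k.
Proof.
rewrite /even_hook_char; case: n n_gt0 => // p _ /=.
rewrite (reindex_onto (fun m : 'I_p./2.+1 => inord m.*2 : 'I_p.+1)
   (fun k : 'I_p.+1 => inord k./2 : 'I_p./2.+1)) /=; last first.
  move=> k ev; have lek : (k <= p)%N by rewrite -ltnS.
  have ltk : (k./2 < p./2.+1)%N by rewrite ltnS half_leq.
  by apply/val_inj; rewrite /= (inordK ltk) even_halfK // inordK.
have dbl (m : 'I_p./2.+1) : (m.*2 < p.+1)%N.
  have lem : (m <= p./2)%N by rewrite -ltnS.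
  rewrite ltnS; apply: (@leq_trans p./2.*2); first by rewrite leq_double.
  by rewrite -[X in (_ <= X)%N]odd_double_half leq_addl.
apply: eq_big => m; last by rewrite inordK.
by rewrite inordK // odd_double doubleK inord_val eqxx.
Qed.

Lemma half_sum (a : 'I_n -> algC) :
  \sum_(k < n | ~~ odd k) a k = (\sum_(k < n) a k + \sum_(k < n) (-1) ^+ k * a
    k) / 2.
Proof.
rewrite -big_split mulr_suml big_mkcond /=; apply: eq_bigr => k _.
rewrite -signr_odd; case: (odd k); first by rewrite mulN1r subrr mul0r.
by rewrite mul1r; field.
Qed.

Lemma even_hook_constituentsE (phi : 'CF([set: 'S_n])) :
  even_hook_constituents phi = '[phi, \sum_(k < n | ~~ odd k) theta k].
Proof.
rewrite cfdot_sumr /even_hook_constituents.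
rewrite (eq_bigr (fun i => \sum_(k < n | ~~ odd k && ('chi_i == theta k))
  '[phi, theta k])); last first.
  move=> i /existsP[k /andP[ev /eqP Di]]; rewrite (bigD1 k) /=; last
    by rewrite ev Di eqxx.
  rewrite -Di big1 ?addr0 // => k' /andP[/andP[_ /eqP Di'] nk].
  have := hook_orth (ltn_ord k) (ltn_ord k');
    rewrite -Di -Di' cfnorm_irr eq_sym.
  by rewrite val_eqE (negPf nk) => /eqP; rewrite oner_eq0.
rewrite (exchange_big_dep (fun k : 'I_n => ~~ odd k)) /=; last
  by move=> i k _ /andP[].
apply: eq_bigr => k ev; have /irrP[i Di] := hook_irr (ltn_ord k).
rewrite (big_pred1 i) // => j; rewrite ev Di (inj_eq irr_inj) /=.
case: eqVneq => [->|]; rewrite ?andbF // andbT.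
by apply/existsP; exists k; rewrite ev Di eqxx.
Qed.

(** In the half of the sum that comes from all hooks, chi may be evaluated at
    s instead of its square: the sum of the hooks vanishes at the other
    permutations. *)
Lemma sqr_cfdot la : is_partition n la ->
  let chi := specht_char n la in
  '[sym_sq chi - alt_sq chi, \sum_(k < n | ~~ odd k) theta k]
    = (\sum_(k < n) '[chi, theta k]
       + n`!%:R^-1 * \sum_s chi (s ^+ 2)%g * (\sum_(k < n) (-1) ^+ k * theta k
         s)) / 2.
Proof.
move=> la_part chi.
have -> : \sum_(k < n) '[chi, theta k]
  = n`!%:R^-1 * \sum_s chi (s ^+ 2)%g * \sum_(k < n) theta k s.
  rewrite -cfdot_sumr cfdotE cardsT card_Sn; congr (_ * _).
  rewrite (eq_bigl xpredT) => [|s]; last by rewrite inE.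
  apply: eq_bigr => s _; rewrite sum_cfunE.
  have -> : (\sum_(k < n) theta k s)^* = \sum_(k < n) theta k s.
    by rewrite rmorph_sum; apply: eq_bigr => k _ /=;
      rewrite specht_char_conj ?is_partition_hook.
  have [/forall_inP odds|] := boolP [forall (X | X \in porbits s), odd #|X|].
    by rewrite specht_sqr_odd.
  rewrite negb_forall_in => /exists_inP[X sX ev].
  by rewrite (hook_sum_even n_gt0 sX ev) !mulr0.
rewrite -mulrDr -big_split /= cfdotE cardsT card_Sn -mulrA; congr (_ * _).
rewrite mulr_suml [LHS](eq_bigl xpredT) => [|s]; last by rewrite inE.
apply: eq_bigr => s _; rewrite -mulrDr -mulrA -half_sum; congr (_ * _).
  by rewrite !cfunE inE !mulr1n; field.
rewrite sum_cfunE rmorph_sum; apply: eq_bigr => k _ /=.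
by rewrite specht_char_conj ?is_partition_hook.
Qed.

(** The scalar product of the alternating sum of the hooks with the trivial
    character, which is the hook of leg length 0. *)
Lemma hook_altsum_total : n`!%:R^-1 * \sum_s (\sum_(k < n) (-1) ^+ k * theta k
  s) = 1.
Proof.
transitivity '[\sum_(k < n) (-1) ^+ k *: theta k, theta 0].
  rewrite cfdotE cardsT card_Sn; congr (_ * _).
  rewrite [RHS](eq_bigl xpredT) => [|s]; last by rewrite inE.
  apply: eq_bigr => s _; rewrite (hook0E n_gt0) conjC1 mulr1 sum_cfunE.
  by apply: eq_bigr => k _; rewrite [RHS]cfunE.
rewrite cfdot_suml (bigD1 (Ordinal n_gt0)) //= scale1r (hook_orth n_gt0 n_gt0)
  eqxx.
rewrite big1 ?addr0 // => k nk; rewrite cfdotZl hook_orth //.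
rewrite (_ : (k == 0 :> nat)%N = false) ?mulr0 //.
by apply: negbTE; move: nk; rewrite -val_eqE.
Qed.

(** Only n-cycles count, and for n odd these fix the same words as their
    squares. *)
Lemma altsum_odd la : is_partition n la -> odd n ->
  let chi := specht_char n la in
  n`!%:R^-1 * \sum_s chi (s ^+ 2)%g * (\sum_(k < n) (-1) ^+ k * theta k s)
    = \sum_(k < n) (-1) ^+ k * '[chi, theta k].
Proof.
move=> la_part oddn chi.
transitivity '[chi, \sum_(k < n) (-1) ^+ k *: theta k]; last first.
  rewrite cfdot_sumr; apply: eq_bigr => k _.
  by rewrite cfdotZr rmorph_sign.
rewrite cfdotE cardsT card_Sn; congr (_ * _).
rewrite [RHS](eq_bigl xpredT) => [|s]; last by rewrite inE.
apply: eq_bigr => s _; rewrite sum_cfunE.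
have -> : (\sum_(k < n) ((-1) ^+ k *: theta k) s)^*
  = \sum_(k < n) (-1) ^+ k * theta k s.
  rewrite rmorph_sum; apply: eq_bigr => k _.
  by rewrite cfunE rmorphM rmorph_sign /= specht_char_conj ?is_partition_hook.
have [one|many] := eqVneq #|porbits s| 1%N; last
  by rewrite (hook_altsum_orbits n_gt0 many) !mulr0.
congr (_ * _); apply: specht_sqr_odd => // X sX.
have /eqP/cards1P[O DO] := one; move: sX; rewrite DO inE => /eqP ->.
suff -> : O = setT by rewrite cardsT card_ord.
apply/setP=> x; rewrite inE.
have /set1P <- : porbit s x \in [set O] by rewrite -DO; apply: imset_f.
exact: porbit_id.
Qed.

(** Only n-cycles count, and for n even their squares have two cycles of
    length m. *)
Lemma altsum_even la m : is_partition n la -> n = m.*2 ->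
  let chi := specht_char n la in
  n`!%:R^-1 * \sum_s chi (s ^+ 2)%g * (\sum_(k < n) (-1) ^+ k * theta k s)
    = two_orbit_value la m.
Proof.
move=> la_part Dn chi; have m_gt0 : (0 < m)%N
  by move: n_gt0; rewrite Dn double_gt0.
apply: etrans (mulr1 _); rewrite -[in RHS]hook_altsum_total mulrCA;
  congr (_ * _); rewrite mulr_sumr.
apply: eq_bigr => s _.
have [one|many] := eqVneq #|porbits s| 1%N; last
  by rewrite (hook_altsum_orbits n_gt0 many) !mulr0.
have [O1 [O2 [sO neO c1 c2]]] := sqr_cycle_two m_gt0 Dn one.
by congr (_ * _); apply: specht_two_orbits sO neO c1 c2.
Qed.

(** An n-cycle exists because the alternating sum of the hooks, supported on
    n-cycles, has mean 1. *)
Lemma two_orbit_hook m k : n = m.*2 -> (k < n)%N ->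
  two_orbit_value (hook n k) m = if (k < m)%N then (-1) ^+ k else (-1) ^+ k.+1.
Proof.
move=> Dn ltkn; have m_gt0 : (0 < m)%N by move: n_gt0; rewrite Dn double_gt0.
have [s one] : exists s, #|porbits s| = 1%N.
  case: (pickP (fun s => #|porbits s| == 1%N)) => [s /eqP|none]; first
    by exists s.
  have := hook_altsum_total; rewrite big1 ?mulr0 => [/eqP|s _].
    by rewrite eq_sym oner_eq0.
  by rewrite hook_altsum_orbits ?none.
have [O1 [O2 [sO neO c1 c2]]] := sqr_cycle_two m_gt0 Dn one.
rewrite -(specht_two_orbits (is_partition_hook ltkn) sO neO c1 c2).
have Dn2 : n = (m + m)%N by rewrite addnn.
by rewrite (hook_two_orbits n_gt0 sO neO c1 c2 _ Dn2) // -Dn2.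
Qed.

Lemma nonhook_cfdot la k : is_partition n la -> ~ is_hook n la -> (k < n)%N ->
  '[specht_char n la, theta k] = 0.
Proof.
move=> la_part nhook ltkn.
have [/irrP[i Di] _] := specht_char_spec la_part;
  have /irrP[j Dj] := hook_irr ltkn.
rewrite Di Dj cfdot_irr; case: eqP => // ij; case: nhook; exists k => //.
by apply: specht_eq_hook => //; rewrite Di Dj ij.
Qed.

End Assembly.

Lemma half_sign_cases k : ((1 + (-1) ^+ k) / 2 : algC) \in [:: -1; 0; 1].
Proof.
rewrite -signr_odd; case: (odd k); rewrite !inE; last
  by rewrite -mulr2n mulfV ?eqxx ?orbT ?pnatr_eq0.
by rewrite subrr mul0r eqxx orbT.
Qed.

Theorem proposition4p3 (n : nat) (la : seq nat) :
  (0 < n)%N -> is_partition n la ->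
  let chi := specht_char n la in
  let v : algC := '[sym_sq chi - alt_sq chi, even_hook_char n] in
  [/\ odd n ->
        (forall k : nat, (k < n)%N -> la = hook n k ->
           v = (1 + (-1) ^+ k) / 2) /\
        (~ is_hook n la -> v = 0),
      ~~ odd n ->
        [/\ forall k : nat, (k < n)%N -> la = hook n k -> (k < n - k)%N ->
              v = (1 + (-1) ^+ k) / 2,
            forall k : nat, (k < n)%N -> la = hook n k -> (n - k <= k)%N ->
              v = (1 + (-1) ^+ k.-1) / 2
          & ~ is_hook n la ->
              forall s : 'S_n, cycle_type s = [:: n./2; n./2] ->
                v = chi s / 2],
      v \in [:: -1; 0; 1]
    & `|even_hook_constituents (sym_sq chi)
        - even_hook_constituents (alt_sq chi)| <= 1].
Proof.
move=> n_gt0 la_part chi v.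
have vE : v = '[sym_sq chi - alt_sq chi,
  \sum_(k < n | ~~ odd k) specht_char n (hook n k)].
  by rewrite /v even_hook_charE.
have sqE := sqr_cfdot n_gt0 la_part; rewrite -/chi /= -vE in sqE.
have hook_dot k (f : nat -> algC) : (k < n)%N -> la = hook n k ->
    \sum_(j < n) f j * '[chi, specht_char n (hook n j)] = f k.
  move=> ltkn Dla; rewrite (bigD1 (Ordinal ltkn)) //= big1 ?addr0.
    by rewrite /chi Dla hook_orth // eqxx mulr1.
  move=> j nj; rewrite /chi Dla hook_orth // eq_sym -[_ == k]/(j == Ordinal
    ltkn).
  by rewrite (negPf nj) mulr0.
have hook_sum k : (k < n)%N -> la = hook n k ->
  \sum_(j < n) '[chi, specht_char n (hook n j)] = 1.
  by move=> ltkn Dla; rewrite -[RHS](hook_dot k (fun=> 1)) //;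
    apply: eq_bigr => j _; rewrite mul1r.
have odd_hook : odd n -> forall k, (k < n)%N -> la = hook n k ->
  v = (1 + (-1) ^+ k) / 2.
  move=> oddn k ltkn Dla; rewrite sqE (hook_sum k) // altsum_odd //.
  by rewrite (hook_dot k (fun j => (-1) ^+ j)).
have odd_nhook : odd n -> ~ is_hook n la -> v = 0.
  move=> oddn nhook; rewrite sqE altsum_odd // !big1 ?addr0 ?mul0r // => k _.
    by rewrite nonhook_cfdot ?mulr0.
  by rewrite nonhook_cfdot.
have even_hook : ~~ odd n -> forall k, (k < n)%N -> la = hook n k ->
    v = (1 + (if (k < n./2)%N then (-1) ^+ k else (-1) ^+ k.+1)) / 2.
  move=> evn k ltkn Dla; have Dn : n = n./2.*2 by rewrite even_halfK.
  by rewrite sqE (hook_sum k) // (altsum_even n_gt0 la_part Dn) Dla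
    two_orbit_hook.
have even_nhook : ~~ odd n -> ~ is_hook n la -> v = two_orbit_value la n./2 / 2.
  move=> evn nhook; have Dn : n = n./2.*2 by rewrite even_halfK.
  rewrite sqE (altsum_even n_gt0 la_part Dn) big1 ?add0r // => k _.
  by rewrite nonhook_cfdot.
have v_small : v \in [:: -1; 0; 1].
  case: (pickP (fun k : 'I_n => la == hook n k)) => [k /eqP Dla|none].
    have [oddn|evn] := boolP (odd n); first
      by rewrite (odd_hook oddn k) // half_sign_cases.
    by rewrite (even_hook evn k) //; case: ifP => _; apply: half_sign_cases.
  have nhook : ~ is_hook n la.
    by case=> k ltkn /eqP; rewrite -[k]/(val (Ordinal ltkn)) none.
  have [oddn|evn] := boolP (odd n); first
    by rewrite odd_nhook // !inE eqxx orbT.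
  have m_gt0 : (0 < n./2)%N by move: n_gt0;
    rewrite -{1}(even_halfK evn) double_gt0.
  rewrite even_nhook //.
  have := two_orbit_value_bound la_part n_gt0 m_gt0 nhook.
  rewrite !inE => /or3P[]/eqP->; rewrite ?mulNr ?mul0r ?divff ?pnatr_eq0 ?eqxx
    ?orbT //.
split=> //.
- move=> oddn; split; [exact: odd_hook | exact: odd_nhook].
- move=> evn; have Dn : n = n./2.*2 by rewrite even_halfK.
  split=> [k ltkn Dla ltk|k ltkn Dla gek|nhook s cs].
  + by rewrite (even_hook evn k) // ifT //; lia.
  + rewrite (even_hook evn k) // ifF; last by apply/negbTE; lia.
    by case: k {ltkn Dla} gek => [|k] gek;
      [lia | rewrite exprS exprS mulN1r mulN1r opprK].
  have [O1 [O2 [sO neO c1 c2]]] := cycle_type_two cs.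
  by rewrite even_nhook // -(specht_two_orbits la_part sO neO c1 c2).
rewrite !even_hook_constituentsE // -cfdotBl -vE.
by move: v_small; rewrite !inE => /or3P[]/eqP->;
  rewrite ?normrN ?normr1 ?normr0 ?ler01.
Qed.
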